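(* Consider the closed-loop power-network/bidding system $\dot x=F(x)$ on $\mathbb R^{4n}$ defined in the context, with an equilibrium $\bar x=\operatorname{col}(\bar\varphi,\bar\omega,\bar b,\bar P_g,\bar\lambda)$ such that $\bar\eta:=D^TD_t^{\dagger T}\bar\varphi\in(-\frac{\pi}{2},\frac{\pi}{2})^m$, and the disturbed system $$\dot x=F(x)+Bd,$$ with $B\in\mathbb R^{4n\times q}$ and disturbance $d\in\mathbb R^q$. For $\varepsilon=\operatorname{col}(\varepsilon_0,\varepsilon_1,\varepsilon_2,\varepsilon_3)\in\mathbb R^4_{>0}$ define $$W_\varepsilon(x)=V(x)+\varepsilon_0\varepsilon_1(\varphi-\bar\varphi)^TD_t^{\dagger}M\omega-\frac{\varepsilon_0\varepsilon_2}{\sigma^2}(b-\bar b)^TT_g(P_g-\bar P_g)-\frac{\varepsilon_0\varepsilon_3}{\sigma^2}(\lambda-\bar\lambda)\mathbf 1^TT_g(P_g-\bar P_g),$$ where $V$ is given in the context. Let $\gamma$ satisfy $\|\bar\eta\|_\infty<\gamma<\frac{\pi}{2}$ and define the closed convex set $$\Omega=\{x=\operatorname{col}(\varphi,\omega,b,P_g,\lambda)\in\mathbb R^{4n} : D^TD_t^{\dagger T}\varphi\in[-\gamma,\gamma]^m\}.$$ Then there exist (sufficiently small) parameters $\varepsilon\in\mathbb R^4_{>0}$ such that $W_\varepsilon$ is an LISS-Lyapunov function of $\dot x=F(x)+Bd$ on $\Omega$. In particular, there exist constants $\alpha,\chi,c_1,c_2>0$ such that for all $x\in\Omega$ and all $d\in\mathbb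 R^q$ satisfying $\|d\|\le\chi\|x-\bar x\|$, $$\tfrac12c_1\|x-\bar x\|^2\le W_\varepsilon(x)\le\tfrac12c_2\|x-\bar x\|^2,$$ $$(\nabla W_\varepsilon(x))^T(F(x)+Bd)\le-\alpha\|x-\bar x\|^2.$$
   Context: Network. Let $\mathcal G=(\mathcal V,\mathcal E)$ be a connected undirected graph with nodes $\mathcal V=\{1,\dots,n\}$ and $m$ edges labeled $1,\dots,m$. Each edge has its ends arbitrarily labeled $+$ and $-$; $D\in\mathbb R^{n\times m}$ is the incidence matrix ($D_{ik}=+1$ if $i$ is the positive end of edge $k$, $-1$ if $i$ is the negative end, $0$ otherwise). Let $D_t\in\mathbb R^{n\times(n-1)}$ be the incidence matrix of a spanning tree of $\mathcal G$ and $D_t^\dagger=(D_t^TD_t)^{-1}D_t^T$ its Moore-Penrose inverse; $D_t^{\dagger T}$ denotes its transpose. $\mathbf 1$ is the all-ones vector, and $\|v\|_A^2:=v^TAv$; $\|\cdot\|$ is the Euclidean norm. Parameters. $\Gamma=\operatorname{diag}\{\gamma_1,\dots,\gamma_m\}$ with $\gamma_k=B_{ij}V_iV_j>0$ for edge $k$ between nodes $i,j$ (voltage magnitudes $V_i>0$, line susceptance constants $B_{ij}>0$). $M,A\in\mathbb R^{n\times n}$ are diagonal with positive diagonal entries (inertia and damping). $P_d\in\mathbb R^n$ is a constant load vector. $Q=\operatorname{diag}\{q_1,\dots,q_n\}$ with $q_i>0$, $c=\operatorname{col}(c_1,\dots,c_n)$ with $c_i\ge0$. $T_b,T_g\in\mathbb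 R^{n\times n}$ are diagonal positive definite, and $\rho,\sigma,\tau_\lambda>0$ are scalars. Potential. $U(\varphi)=-\mathbf 1^T\Gamma\cos(D^TD_t^{\dagger T}\varphi)$ for $\varphi\in\mathbb R^{n-1}$, with $\cos$ applied componentwise. Closed-loop system. The state is $x=\operatorname{col}(\varphi,\omega,b,P_g,\lambda)\in\mathbb R^{n-1}\times\mathbb R^n\times\mathbb R^n\times\mathbb R^n\times\mathbb R=\mathbb R^{4n}$, and $\dot x=F(x)$ denotes the system $$\dot\varphi=D_t^T\omega,$$ $$M\dot\omega=-D_t\nabla U(\varphi)-A\omega+P_g-P_d,$$ $$T_b\dot b=P_g-Q^{-1}b+Q^{-1}c,$$ $$T_g\dot P_g=\mathbf 1\lambda-b+\rho\mathbf 1\mathbf 1^T(P_d-P_g)-\sigma^2\omega,$$ $$\tau_\lambda\dot\lambda=\mathbf 1^T(P_d-P_g).$$ It is a standing assumption that an equilibrium $\bar x$ with $D^TD_t^{\dagger T}\bar\varphi\in(-\frac\pi2,\frac\pi2)^m$ exists (necessarily $\bar\omega=0$). Function $V$. $$V(x)=U(\varphi)-(\varphi-\bar\varphi)^T\nabla U(\bar\varphi)-U(\bar\varphi)+\tfrac12\omega^TM\omega+\tfrac1{2\sigma^2}\big(\|b-\bar b\|_{T_b}^2+\|P_g-\bar P_g\|_{T_g}^2+\tau_\lambda(\lambda-\bar\lambda)^2\big).$$ LISS-Lyapunov function. A continuously differentiable $W$ is an LISS (local input-to-state stability) Lyapunov function of $\dot x=F(x)+Bd$ on $\Omega$ (relative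 to $\bar x$) if there are class-$\mathcal K_\infty$ functions $a_1,a_2,a_3,\kappa$ such that for all $x\in\Omega$: $a_1(\|x-\bar x\|)\le W(x)\le a_2(\|x-\bar x\|)$, and $\nabla W(x)^T(F(x)+Bd)\le-a_3(\|x-\bar x\|)$ for all $d\in\mathbb R^q$ with $\|d\|\le\kappa(\|x-\bar x\|)$. *)

(* Defs.v *)
From HB Require Import structures.
From mathcomp Require Import all_boot all_order all_algebra.
From mathcomp Require Import all_classical all_reals all_analysis.

Set Implicit Arguments.
Unset Strict Implicit.
Unset Printing Implicit Defensive.

Import Order.TTheory GRing.Theory Num.Theory.
Import numFieldNormedType.Exports.

Local Open Scope classical_set_scope.
Local Open Scope ring_scope.

(* The library's norm on 'cV[R]_k is the sup norm, hence [enorm]; the topology,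
   and so the notions of derivative and continuity, do not depend on this. *)
Definition dot (R : realType) (k : nat) (u v : 'cV[R]_k) : R :=
  (u^T *m v) 0 0.

Definition enorm (R : realType) (k : nat) (v : 'cV[R]_k) : R :=
  Num.sqrt (dot v v).

(* The weighted square [|v|_A^2]. *)
Definition wsqnorm (R : realType) (k : nat) (A : 'M[R]_k) (v : 'cV[R]_k) : R :=
  dot v (A *m v).

Definition ones (R : realType) (k : nat) : 'cV[R]_k := const_mx 1.

Definition gradient (R : realType) (k : nat) (f : 'cV[R]_k -> R)
    (x : 'cV[R]_k) : 'cV[R]_k :=
  \col_i 'D_(delta_mx i 0) f x.

Definition continuously_differentiable (R : realType) (k : nat)
    (f : 'cV[R]_k -> R) : Prop :=
  (forall x, differentiable f x) /\ continuous (gradient f).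

Definition positive_diagonal (R : realType) (k : nat) (A : 'M[R]_k) : Prop :=
  is_diag_mx A /\ forall i, 0 < A i i.

Definition positive_definite (R : realType) (k : nat) (A : 'M[R]_k) : Prop :=
  A^T = A /\ forall v : 'cV[R]_k, v != 0 -> 0 < wsqnorm A v.

(* A class-K_infinity function lives on [0, +oo[; its values at negative
   arguments are irrelevant. *)
Definition class_Kinfty (R : realType) (a : R -> R) : Prop :=
  [/\ a 0 = 0,
      {within `[0, +oo[, continuous a},
      {in `[0, +oo[ &, {homo a : x y / x < y}} &
      a r @[r --> +oo] --> +oo].

Definition LISS_Lyapunov (R : realType) (k q : nat)
    (F : 'cV[R]_k -> 'cV[R]_k) (B : 'M[R]_(k, q)) (Omega : set 'cV[R]_k)
    (xbar : 'cV[R]_k) (W : 'cV[R]_k -> R) : Prop :=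
  continuously_differentiable W /\
  exists a1 a2 a3 kappa : R -> R,
    [/\ class_Kinfty a1, class_Kinfty a2, class_Kinfty a3 & class_Kinfty kappa]
    /\ forall x, Omega x ->
         a1 (enorm (x - xbar)) <= W x <= a2 (enorm (x - xbar)) /\
         forall d : 'cV[R]_q, enorm d <= kappa (enorm (x - xbar)) ->
           dot (gradient W x) (F x + B *m d) <= - a3 (enorm (x - xbar)).

(* Simple graphs on 'I_n are symmetric irreflexive relations. *)
Definition simple_graph (n : nat) (e : rel 'I_n) : Prop :=
  symmetric e /\ irreflexive e.

Definition connected_graph (n : nat) (e : rel 'I_n) : Prop :=
  (0 < n)%N /\ forall i j, connect e i j.

Definition acyclic_graph (n : nat) (e : rel 'I_n) : Prop :=
  forall s : seq 'I_n, (2 < size s)%N -> ~ ucycle e s.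

Definition spanning_tree (n : nat) (e t : rel 'I_n) : Prop :=
  [/\ simple_graph t, subrel t e, connected_graph t & acyclic_graph t].

(* The edges of e are labelled 'I_m, each exactly once; [pos k] and [neg k] are
   the (arbitrarily chosen) positive and negative ends of edge k. *)
Definition edge_labelling (n m : nat) (e : rel 'I_n) (pos neg : 'I_m -> 'I_n) :
    Prop :=
  (forall k, e (pos k) (neg k)) /\
  forall i j, e i j ->
    exists! k, (pos k = i /\ neg k = j) \/ (pos k = j /\ neg k = i).

Definition incidence (R : realType) (n m : nat) (pos neg : 'I_m -> 'I_n) :
    'M[R]_(n, m) :=
  \matrix_(i, k) (if i == pos k then 1 else if i == neg k then -1 else 0).

Record bidding_network (R : realType) (n m : nat) := BiddingNetwork {
  edge : rel 'I_n;
  epos : 'I_m -> 'I_n;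
  eneg : 'I_m -> 'I_n;
  tree : rel 'I_n;
  tpos : 'I_n.-1 -> 'I_n;
  tneg : 'I_n.-1 -> 'I_n;
  voltage : 'I_n -> R;
  susceptance : 'I_n -> 'I_n -> R;
  inertia : 'M[R]_n;
  damping : 'M[R]_n;
  load : 'cV[R]_n;
  qcost : 'rV[R]_n;
  ccost : 'cV[R]_n;
  Tb : 'M[R]_n;
  Tg : 'M[R]_n;
  rho : R;
  sigma : R;
  tau : R
}.

(* Susceptances are only constrained on edges, where the symmetry makes the
   weight of an edge independent of the choice of its positive end. *)
Record standing_assumptions (R : realType) (n m : nat)
    (N : bidding_network R n m) : Prop := StandingAssumptions {
  edge_simple : simple_graph (edge N);
  edge_connected : connected_graph (edge N);
  edge_labelled : edge_labelling (edge N) (epos N) (eneg N);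
  tree_spanning : spanning_tree (edge N) (tree N);
  tree_labelled : edge_labelling (tree N) (tpos N) (tneg N);
  voltage_gt0 : forall i, 0 < voltage N i;
  susceptance_sym :
    forall i j, edge N i j -> susceptance N i j = susceptance N j i;
  susceptance_gt0 : forall i j, edge N i j -> 0 < susceptance N i j;
  inertia_pos : positive_diagonal (inertia N);
  damping_pos : positive_diagonal (damping N);
  qcost_gt0 : forall i, 0 < qcost N 0 i;
  ccost_ge0 : forall i, 0 <= ccost N i 0;
  Tb_diag : is_diag_mx (Tb N);
  Tb_posdef : positive_definite (Tb N);
  Tg_diag : is_diag_mx (Tg N);
  Tg_posdef : positive_definite (Tg N);
  rho_gt0 : 0 < rho N;
  sigma_gt0 : 0 < sigma N;
  tau_gt0 : 0 < tau N
}.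

Definition Dinc (R : realType) (n m : nat) (N : bidding_network R n m) :
    'M[R]_(n, m) :=
  incidence R (epos N) (eneg N).

Definition Dtree (R : realType) (n m : nat) (N : bidding_network R n m) :
    'M[R]_(n, n.-1) :=
  incidence R (tpos N) (tneg N).

(* The Moore-Penrose inverse of [Dtree N], which has full column rank. *)
Definition Dtree_pinv (R : realType) (n m : nat) (N : bidding_network R n m) :
    'M[R]_(n.-1, n) :=
  invmx ((Dtree N)^T *m Dtree N) *m (Dtree N)^T.

Definition Gamma (R : realType) (n m : nat) (N : bidding_network R n m) :
    'M[R]_m :=
  diag_mx (\row_k (susceptance N (epos N k) (eneg N k)
                   * voltage N (epos N k) * voltage N (eneg N k))).

Definition Qmx (R : realType) (n m : nat) (N : bidding_network R n m) :
    'M[R]_n :=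
  diag_mx (qcost N).

(* Voltage angle differences over the lines. *)
Definition line_angles (R : realType) (n m : nat) (N : bidding_network R n m)
    (phi : 'cV[R]_(n.-1)) : 'cV[R]_m :=
  (Dinc N)^T *m ((Dtree_pinv N)^T *m phi).

Definition potential (R : realType) (n m : nat) (N : bidding_network R n m)
    (phi : 'cV[R]_(n.-1)) : R :=
  - dot (ones R m) (Gamma N *m map_mx cos (line_angles N phi)).

(* The state col(phi, omega, b, Pg, lambda); the dimension is 4n for n > 0. *)
Notation state_dim n := (n.-1 + (n + (n + (n + 1))))%N.

Definition st_phi (R : realType) (n : nat) (x : 'cV[R]_(state_dim n)) :
    'cV[R]_(n.-1) :=
  usubmx x.

Definition st_omega (R : realType) (n : nat) (x : 'cV[R]_(state_dim n)) :
    'cV[R]_n :=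
  usubmx (dsubmx x).

Definition st_b (R : realType) (n : nat) (x : 'cV[R]_(state_dim n)) :
    'cV[R]_n :=
  usubmx (dsubmx (dsubmx x)).

Definition st_Pg (R : realType) (n : nat) (x : 'cV[R]_(state_dim n)) :
    'cV[R]_n :=
  usubmx (dsubmx (dsubmx (dsubmx x))).

Definition st_lambda (R : realType) (n : nat) (x : 'cV[R]_(state_dim n)) : R :=
  dsubmx (dsubmx (dsubmx (dsubmx x))) 0 0.

Definition col_state (R : realType) (n : nat) (phi : 'cV[R]_(n.-1))
    (omega b Pg : 'cV[R]_n) (lambda : R) : 'cV[R]_(state_dim n) :=
  col_mx phi (col_mx omega (col_mx b (col_mx Pg lambda%:M))).

Definition closed_loop (R : realType) (n m : nat) (N : bidding_network R n m)
    (x : 'cV[R]_(state_dim n)) : 'cV[R]_(state_dim n) :=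
  let phi := st_phi x in let omega := st_omega x in let b := st_b x in
  let Pg := st_Pg x in let lambda := st_lambda x in
  col_state
    ((Dtree N)^T *m omega)
    (invmx (inertia N) *m
      (- (Dtree N *m gradient (potential N) phi) - damping N *m omega
       + Pg - load N))
    (invmx (Tb N) *m (Pg - invmx (Qmx N) *m b + invmx (Qmx N) *m ccost N))
    (invmx (Tg N) *m
      (lambda *: ones R n - b
       + rho N *: (ones R n *m (ones R n)^T *m (load N - Pg))
       - sigma N ^+ 2 *: omega))
    ((tau N)^-1 * dot (ones R n) (load N - Pg)).

Definition Vfun (R : realType) (n m : nat) (N : bidding_network R n m)
    (xbar x : 'cV[R]_(state_dim n)) : R :=
  potential N (st_phi x)
  - dot (st_phi x - st_phi xbar) (gradient (potential N) (st_phi xbar))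
  - potential N (st_phi xbar)
  + 2^-1 * dot (st_omega x) (inertia N *m st_omega x)
  + (2 * sigma N ^+ 2)^-1 *
      (wsqnorm (Tb N) (st_b x - st_b xbar)
       + wsqnorm (Tg N) (st_Pg x - st_Pg xbar)
       + tau N * (st_lambda x - st_lambda xbar) ^+ 2).

Definition Weps (R : realType) (n m : nat) (N : bidding_network R n m)
    (xbar : 'cV[R]_(state_dim n)) (eps0 eps1 eps2 eps3 : R)
    (x : 'cV[R]_(state_dim n)) : R :=
  Vfun N xbar x
  + eps0 * eps1 *
      dot (st_phi x - st_phi xbar) (Dtree_pinv N *m (inertia N *m st_omega x))
  - eps0 * eps2 / sigma N ^+ 2 *
      dot (st_b x - st_b xbar) (Tg N *m (st_Pg x - st_Pg xbar))
  - eps0 * eps3 / sigma N ^+ 2 *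
      ((st_lambda x - st_lambda xbar) *
       dot (ones R n) (Tg N *m (st_Pg x - st_Pg xbar))).

Definition angle_region (R : realType) (n m : nat) (N : bidding_network R n m)
    (gamma : R) : set 'cV[R]_(state_dim n) :=
  [set x | forall k, - gamma <= line_angles N (st_phi x) k 0 <= gamma].

(* Main.v *)
Require Import Defs.
From HB Require Import structures.
From mathcomp Require Import all_boot all_order all_algebra.
From mathcomp Require Import all_classical all_reals all_analysis.
From mathcomp Require Import ring lra.

Set Implicit Arguments.
Unset Strict Implicit.
Unset Printing Implicit Defensive.

Import Order.TTheory GRing.Theory Num.Theory.
Import numFieldNormedType.Exports.

Local Open Scope classical_set_scope.
Local Open Scope ring_scope.

(** In deviations from the equilibrium the derivative of V along the closed loop
    is -w'Aw - s b'Q^-1 b - s rho (1'p)^2, with s = 1/sigma^2, which controls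
    only w and b.  The first cross term supplies -|phi|^2, because the gradient
    of U is strongly monotone on the region |eta_k| <= gamma < pi/2; the second
    supplies -|p|^2 and the third -lambda^2.  Taking eps2 = 1 and
    eps1 = eps3 = delta small, the -|p|^2 absorbs the positive |p|^2 produced by
    the other two; everything else the cross terms produce is then absorbed by
    the dissipation in w and b once eps0 is small.  A disturbance enters the
    derivative through grad W, which is O(|x - xbar|) on the region, so a
    disturbance that is small relative to |x - xbar| costs at most half of the
    decay. *)

(** * Euclidean inner product and incidence matrices *)

(** Each cross term pairs a state that has no dissipation of its own with a state whose rate
    contains it: the rate of [omega] contains minus the gradient of [U], that of [b] contains [p],
    that of [Pg] contains [lambda], which dictates the signs in [Weps]. Decay in [p] is thus paid
    for by [b], and decay in [lambda] by [p], so the weights must be ordered. [eps0] has a second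
    duty: the cross terms must not destroy the positivity of [Weps]. The constants for this are
    uniform in [delta] up to 1, so a cap on [eps0] is known before [delta] and [eps0] are chosen,
    and there is no circularity. Once a single coercivity constant [c] and a single bound [K] are
    extracted from all the matrices, the decay is a quadratic inequality in five real numbers, the
    norms of the components. The region enters because the angles between two points of an interval
    stay in it, so mean value arguments see only derivatives [cos] at least [cos gamma > 0]. *)

Lemma dotE (R : realType) (k : nat) (u v : 'cV[R]_k) :
  dot u v = \sum_i u i 0 * v i 0.
Proof. by rewrite /dot mxE; apply: eq_bigr => i _; rewrite mxE. Qed.

Lemma dotC (R : realType) (k : nat) (u v : 'cV[R]_k) : dot u v = dot v u.
Proof. by rewrite !dotE; apply: eq_bigr => i _; rewrite mulrC. Qed.

Lemma dotDl (R : realType) (k : nat) (u v w : 'cV[R]_k) :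
  dot (u + v) w = dot u w + dot v w.
Proof. by rewrite /dot linearD mulmxDl mxE. Qed.

Lemma dotNl (R : realType) (k : nat) (u w : 'cV[R]_k) :
  dot (- u) w = - dot u w.
Proof. by rewrite /dot linearN mulNmx mxE. Qed.

Lemma dotZl (R : realType) (k : nat) (a : R) (u w : 'cV[R]_k) :
  dot (a *: u) w = a * dot u w.
Proof. by rewrite /dot linearZ -scalemxAl mxE. Qed.

Lemma dotDr (R : realType) (k : nat) (u v w : 'cV[R]_k) :
  dot w (u + v) = dot w u + dot w v.
Proof. by rewrite dotC dotDl !(dotC w). Qed.

Lemma dotNr (R : realType) (k : nat) (u w : 'cV[R]_k) :
  dot w (- u) = - dot w u.
Proof. by rewrite dotC dotNl dotC. Qed.

Lemma dotZr (R : realType) (k : nat) (a : R) (u w : 'cV[R]_k) :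
  dot w (a *: u) = a * dot w u.
Proof. by rewrite dotC dotZl dotC. Qed.

Lemma dot0l (R : realType) (k : nat) (w : 'cV[R]_k) : dot 0 w = 0.
Proof. by rewrite /dot trmx0 mul0mx mxE. Qed.

Lemma dot0r (R : realType) (k : nat) (w : 'cV[R]_k) : dot w 0 = 0.
Proof. by rewrite dotC dot0l. Qed.

Lemma dot_mulmxl (R : realType) (k l : nat) (A : 'M[R]_(k, l)) u v :
  dot (A *m u) v = dot u (A^T *m v).
Proof. by rewrite /dot trmx_mul mulmxA. Qed.

Lemma dot_col_mx (R : realType) (k l : nat) (u u' : 'cV[R]_k)
    (v v' : 'cV[R]_l) :
  dot (col_mx u v) (col_mx u' v') = dot u u' + dot v v'.
Proof. by rewrite /dot tr_col_mx mul_row_col mxE. Qed.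

Lemma dot_ge0 (R : realType) (k : nat) (u : 'cV[R]_k) : 0 <= dot u u.
Proof. by rewrite dotE sumr_ge0// => i _; rewrite -expr2 sqr_ge0. Qed.

Lemma dot_eq0 (R : realType) (k : nat) (u : 'cV[R]_k) : dot u u = 0 -> u = 0.
Proof.
rewrite dotE => /eqP; rewrite psumr_eq0 => [/allP u0|i _]; last first.
  by rewrite -expr2 sqr_ge0.
apply/colP => i; rewrite mxE; apply/eqP.
by have := u0 i (mem_index_enum _); rewrite /= mulf_eq0 orbb.
Qed.

Lemma enorm_ge0 (R : realType) (k : nat) (u : 'cV[R]_k) : 0 <= enorm u.
Proof. exact: sqrtr_ge0. Qed.

Lemma enorm_sqr (R : realType) (k : nat) (u : 'cV[R]_k) :
  enorm u ^+ 2 = dot u u.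
Proof. by rewrite sqr_sqrtr// dot_ge0. Qed.

Lemma coord_le_enorm (R : realType) (k : nat) (u : 'cV[R]_k) i :
  `|u i 0| <= enorm u.
Proof.
rewrite -ler_sqr ?nnegrE ?enorm_ge0// enorm_sqr dotE (bigD1 i)//=.
rewrite real_normK ?num_real// expr2 lerDl sumr_ge0// => j _.
by rewrite -expr2 sqr_ge0.
Qed.

(** The sum of the absolute entries is a crude constant, but only the existence of such bounds
    matters below. *)
Lemma dot_mulmx_bound (R : realType) (k l : nat) (A : 'M[R]_(k, l)) :
  exists2 C, 0 <= C & forall u v, `|dot u (A *m v)| <= C * (enorm u * enorm v).
Proof.
exists (\sum_i \sum_j `|A i j|).
  by apply: sumr_ge0 => i _; apply: sumr_ge0.
move=> u v; rewrite dotE (le_trans (ler_norm_sum _ _ _))// mulr_suml.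
apply: ler_sum => i _; rewrite mxE mulr_sumr mulr_suml.
rewrite (le_trans (ler_norm_sum _ _ _))//; apply: ler_sum => j _.
rewrite !normrM mulrCA ler_wpM2l//.
by rewrite ler_pM// coord_le_enorm.
Qed.

Lemma dot_cauchy_schwarz (R : realType) (k : nat) (u v : 'cV[R]_k) :
  `|dot u v| <= enorm u * enorm v.
Proof.
have eq0 (z : 'cV[R]_k) : enorm z = 0 -> z = 0.
  by move=> z0; apply: dot_eq0; rewrite -enorm_sqr z0 expr0n.
have := enorm_ge0 u; rewrite le_eqVlt => /predU1P[/esym u0|u0].
  by rewrite u0 mul0r (eq0 u u0) dot0l normr0.
have := enorm_ge0 v; rewrite le_eqVlt => /predU1P[/esym v0|v0].
  by rewrite v0 mulr0 (eq0 v v0) dot0r normr0.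
have uv0 : 0 < enorm u * enorm v by rewrite mulr_gt0.
(* For [a] equal to 1 or -1 the expanded square has the factor [enorm u * enorm v], positive once
   zero vectors are set aside; dividing by it leaves the two signs of the claim. *)
have E (a : R) : dot (enorm v *: u + (a * enorm u) *: v)
    (enorm v *: u + (a * enorm u) *: v) =
  (enorm u * enorm v) * ((1 + a ^+ 2) * (enorm u * enorm v) + 2 * a * dot u v).
  rewrite !dotDl !dotDr !dotZl !dotZr -!enorm_sqr (dotC v u); ring.
have := dot_ge0 (enorm v *: u + (1 * enorm u) *: v).
have := dot_ge0 (enorm v *: u + (-1 * enorm u) *: v).
rewrite !E !pmulr_rge0// ler_norml => h1 h2.
by apply/andP; split; lra.
Qed.

(** The bilinear bound at [u := A *m v] gives [|Av|^2 <= C |Av| |v|], and one factor [|Av|] cancels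
    unless it is zero. *)
Lemma enorm_mulmx (R : realType) (k l : nat) (A : 'M[R]_(k, l)) :
  exists2 C, 0 <= C & forall v, enorm (A *m v) <= C * enorm v.
Proof.
have [C C0 CP] := dot_mulmx_bound A; exists C => // v.
have := CP (A *m v) v; rewrite ger0_norm ?dot_ge0// -enorm_sqr expr2 mulrCA.
have := enorm_ge0 (A *m v); rewrite le_eqVlt => /predU1P[<- _|Av0].
  by rewrite mulr_ge0// enorm_ge0.
by rewrite ler_pM2l.
Qed.

Lemma positive_diagonal_coercive (R : realType) (k : nat) (A : 'M[R]_k) :
  positive_diagonal A ->
  exists2 c, 0 < c & forall v, c * dot v v <= dot v (A *m v).
Proof.
move=> [/diag_mxP[r ->] r0].
have {}r0 i : 0 < r 0 i by have := r0 i; rewrite mxE eqxx.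
(* The sum dominates every single inverse, so its own inverse lies below every diagonal entry; the 1
   keeps it positive when [k = 0]. *)
exists (1 + \sum_i (r 0 i)^-1)^-1.
  by rewrite invr_gt0 ltr_wpDr// sumr_ge0// => i _; rewrite invr_ge0 ltW.
move=> v; rewrite !dotE mulr_sumr ler_sum// => i _.
rewrite mul_diag_mx mxE [leRHS]mulrCA -expr2 ler_wpM2r ?sqr_ge0//.
rewrite -[leRHS]invrK lef_pV2 ?posrE ?invr_gt0//; last first.
  by rewrite ltr_wpDr// sumr_ge0// => j _; rewrite invr_ge0 ltW.
rewrite (bigD1 i)//= addrCA lerDl addr_ge0// sumr_ge0// => j _.
by rewrite invr_ge0 ltW.
Qed.

Lemma positive_diagonal_trmx (R : realType) (k : nat) (A : 'M[R]_k) :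
  positive_diagonal A -> A^T = A.
Proof. by move=> [/diag_mxP[r ->] _]; rewrite tr_diag_mx. Qed.

Lemma positive_diagonal_inv (R : realType) (k : nat) (A : 'M[R]_k) :
  positive_diagonal A -> A \in unitmx /\ positive_diagonal (invmx A).
Proof.
move=> [/diag_mxP[r ->] r0].
have {}r0 i : 0 < r 0 i by have := r0 i; rewrite mxE eqxx.
have rV : diag_mx r *m diag_mx (\row_i (r 0 i)^-1) = 1%:M.
  rewrite mulmx_diag -[RHS]diag_const_mx; congr diag_mx.
  by apply/rowP => i; rewrite !mxE mulfV// gt_eqF.
have [rU _] := mulmx1_unit rV; split=> //.
have -> : invmx (diag_mx r) = diag_mx (\row_i (r 0 i)^-1).
  by rewrite -[LHS]mulmx1 -rV mulKmx.
split; first exact: diag_mx_is_diag.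
by move=> i; rewrite !mxE eqxx mulr1n invr_gt0.
Qed.

Lemma positive_diagonal_mul (R : realType) (k : nat) (A B : 'M[R]_k) :
  positive_diagonal A -> positive_diagonal B -> positive_diagonal (A *m B).
Proof.
move=> [/diag_mxP[a ->] a0] [/diag_mxP[b ->] b0].
rewrite mulmx_diag; split; first exact: diag_mx_is_diag.
move=> i; rewrite !mxE eqxx mulr1n mulr_gt0//.
  by have := a0 i; rewrite mxE eqxx.
by have := b0 i; rewrite mxE eqxx.
Qed.

Lemma positive_definite_diagonal (R : realType) (k : nat) (A : 'M[R]_k) :
  is_diag_mx A -> positive_definite A -> positive_diagonal A.
Proof.
move=> dA [_ pA]; split=> // i.
have := pA (delta_mx i 0); rewrite /wsqnorm.
have -> : dot (delta_mx i 0) (A *m delta_mx i 0) = A i i.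
  by rewrite -colE /dot trmx_delta -rowE !mxE.
apply; apply/eqP => /matrixP/(_ i 0); rewrite !mxE !eqxx => /eqP.
by rewrite oner_eq0.
Qed.

(** * Kernel and rank of incidence matrices *)

Lemma incidence_mul (R : realType) (n m : nat) (pos neg : 'I_m -> 'I_n)
    (u : 'rV[R]_n) k :
  pos k != neg k ->
  (u *m incidence R pos neg) 0 k = u 0 (pos k) - u 0 (neg k).
Proof.
move=> pn; rewrite mxE (bigD1 (pos k))//= (bigD1 (neg k)) 1?eq_sym//=.
rewrite !mxE !eqxx eq_sym (negPf pn) mulr1 mulrN1 big1 ?addr0//.
by move=> i /andP[/negPf ip /negPf iN]; rewrite mxE ip iN mulr0.
Qed.

Lemma edge_labelling_neq (n m : nat) (e : rel 'I_n) (pos neg : 'I_m -> 'I_n) :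
  simple_graph e -> edge_labelling e pos neg -> forall k, pos k != neg k.
Proof.
move=> [_ irr] [lab _] k; apply/eqP => pn.
by have := lab k; rewrite pn irr.
Qed.

(** An entry of the product is the difference of [u] across an edge, so [u] is constant along every
    path. *)
Lemma incidence_ker (R : realType) (n m : nat) (e : rel 'I_n)
    (pos neg : 'I_m -> 'I_n) (u : 'rV[R]_n) :
  simple_graph e -> connected_graph e -> edge_labelling e pos neg ->
  u *m incidence R pos neg = 0 -> forall i j, u 0 i = u 0 j.
Proof.
move=> se [_ ce] le uD i j; have /connectP[p + ->] := ce i j.
elim: p i => //= x p IH i /andP[eix px]; rewrite -(IH x px).
have [k [kix _]] := le.2 i x eix.
have /rowP/(_ k) := uD; rewrite incidence_mul ?(edge_labelling_neq se le)// [RHS]mxE.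
by move/eqP; rewrite subr_eq0 => /eqP; case: kix => -[-> ->].
Qed.

Lemma ones_incidence (R : realType) (n m : nat) (e : rel 'I_n)
    (pos neg : 'I_m -> 'I_n) :
  simple_graph e -> edge_labelling e pos neg ->
  (ones R n)^T *m incidence R pos neg = 0.
Proof.
move=> se le; apply/rowP => k.
by rewrite incidence_mul ?(edge_labelling_neq se le)// !mxE subrr.
Qed.

(* The left kernel of the incidence matrix is spanned by [ones], and there are
   n - 1 columns: rank-nullity gives full column rank, without acyclicity. *)
Lemma incidence_col_free (R : realType) (n : nat) (e : rel 'I_n)
    (pos neg : 'I_n.-1 -> 'I_n) :
  simple_graph e -> connected_graph e -> edge_labelling e pos neg ->
  row_free (incidence R pos neg)^T.
Proof.
move=> se ce le; set D := incidence R pos neg.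
have n0 := ce.1.
have kD : (kermx D <= (ones R n)^T)%MS.
  apply/row_subP => i; have kDi : row i (kermx D) *m D = 0.
    by rewrite -row_mul mulmx_ker row0.
  have ker := incidence_ker se ce le kDi.
  apply/submxP; exists (row i (kermx D) 0 (Ordinal n0))%:M.
  rewrite mul_scalar_mx; apply/rowP => j.
  by rewrite [RHS]mxE [_^T _ _]mxE [ones R n _ _]mxE mulr1; apply: ker.
have := leq_trans (mxrankS kD) (rank_leq_row _).
rewrite mxrank_ker /row_free mxrank_tr eqn_leq rank_leq_col/=.
by rewrite leq_subLR; move: (\rank D) => r; rewrite -subn1 leq_subLR addnC.
Qed.

Section TreeInverse.
Variables (R : realType) (n m : nat) (N : bidding_network R n m).
Hypothesis hS : standing_assumptions N.

(** Full column rank makes the Gram matrix invertible: a [v] that it kills gives [v *m (Dtree N)^T]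
    norm zero. *)
Lemma Dtree_pinv_mul : Dtree_pinv N *m Dtree N = 1%:M.
Proof.
rewrite /Dtree_pinv -mulmxA mulVmx//.
have fr : row_free (Dtree N)^T.
  apply: incidence_col_free (tree_labelled hS); by case: (tree_spanning hS).
rewrite -row_free_unit; apply: inj_row_free => v vD.
suff : v *m (Dtree N)^T = 0 by move/eqP; rewrite mulmx_free_eq0// => /eqP.
apply: trmx_inj; rewrite trmx0; apply: dot_eq0.
by rewrite /dot trmxK trmx_mul trmxK mulmxA -(mulmxA v) vD mul0mx mxE.
Qed.

Lemma ones_Dtree : (ones R n)^T *m Dtree N = 0.
Proof.
by apply: ones_incidence (tree_labelled hS); case: (tree_spanning hS).
Qed.

(** The line angles determine [phi]. If [v *m Dtree_pinv N] is killed by the incidence matrix of the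
    connected graph, it is a multiple of [ones], which the tree incidence matrix kills in turn, so
    [v = 0]. A right inverse of [H] then bounds [phi] by its line angles. *)
Lemma line_angles_coercive :
  exists2 c, 0 < c &
    forall phi, c * dot phi phi <= dot (line_angles N phi) (line_angles N phi).
Proof.
set H := (Dtree_pinv N) *m Dinc N.
have fr : row_free H.
  apply: inj_row_free => v; rewrite mulmxA => vH.
  have cst := incidence_ker (edge_simple hS) (edge_connected hS)
    (edge_labelled hS) vH.
  have [i0 _] : exists i : 'I_n, True.
    by exists (Ordinal (edge_connected hS).1).
  have vE : v *m Dtree_pinv N = (v *m Dtree_pinv N) 0 i0 *: (ones R n)^T.
    apply/rowP => i; rewrite [RHS]mxE [_^T _ _]mxE [ones R n _ _]mxE mulr1.
    exact: cst.
  rewrite -[v]mulmx1 -Dtree_pinv_mul mulmxA vE -scalemxAl ones_Dtree.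
  by rewrite scaler0.
have /row_freeP[L HL] := fr.
have HE phi : line_angles N phi = H^T *m phi.
  by rewrite /H trmx_mul -mulmxA.
have [C C0 CP] := dot_mulmx_bound L^T.
exists (1 + C ^+ 2)^-1 => [|phi]; first by rewrite invr_gt0 ltr_pwDl// sqr_ge0.
have phiE : L^T *m (line_angles N phi) = phi.
  by rewrite HE mulmxA -trmx_mul HL trmx1 mul1mx.
have := CP phi (line_angles N phi).
rewrite phiE ger0_norm ?dot_ge0// -!enorm_sqr.
rewrite ler_pdivrMl ?ltr_pwDl ?sqr_ge0//.
have := enorm_ge0 phi; have := enorm_ge0 (line_angles N phi).
move: (enorm phi) (enorm _) => x y y0.
rewrite le_eqVlt => /predU1P[<- _|x0].
  by rewrite expr0n mulr_ge0 ?sqr_ge0// addr_ge0// sqr_ge0.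
rewrite expr2 mulrCA ler_pM2l// -expr2 => xy.
have : x ^+ 2 <= (C * y) ^+ 2 by rewrite ler_sqr ?nnegrE ?mulr_ge0// ltW.
move=> /le_trans; apply; rewrite exprMn ler_wpM2r ?sqr_ge0//; lra.
Qed.

End TreeInverse.

(** * Continuously differentiable functions *)

(** The derivative is carried along, so that combining the closure lemmas also computes it.
    Continuity is asked for each fixed direction; in finite dimension this gives continuity of the
    gradient. *)
Definition C1_with (R : realType) (k : nat) (f : 'cV[R]_k -> R)
    (df : 'cV[R]_k -> 'cV[R]_k -> R) : Prop :=
  (forall x, is_diff x f (df x)) /\ (forall v, continuous (df^~ v)).

(** Working coordinate by coordinate keeps every differentiation scalar-valued. *)
Definition C1v_with (R : realType) (k l : nat) (F : 'cV[R]_k -> 'cV[R]_l)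
    (dF : 'cV[R]_k -> 'cV[R]_k -> 'cV[R]_l) : Prop :=
  forall i, C1_with (fun x => F x i 0) (fun x v => dF x v i 0).

Section C1Theory.
Variables (R : realType) (k : nat).
Implicit Types (f g : 'cV[R]_k -> R) (df dg : 'cV[R]_k -> 'cV[R]_k -> R).

Lemma C1_continuous f df : C1_with f df -> continuous f.
Proof. by move=> [fd _] x; exact: differentiable_continuous. Qed.

Lemma C1_ext f df f' df' : C1_with f df -> (forall x, f' x = f x) ->
  (forall x v, df' x v = df x v) -> C1_with f' df'.
Proof.
move=> fd /funext-> dE.
by have -> : df' = df by apply/funext => x; apply/funext => v.
Qed.

Lemma C1_cst c : C1_with (fun _ : 'cV[R]_k => c) (fun _ _ => 0).
Proof. by split=> [x|v x]; [exact: is_diff_cst|exact: cst_continuous]. Qed.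

Lemma C1_coord i : C1_with (fun x : 'cV[R]_k => x i 0) (fun _ v => v i 0).
Proof.
split=> [x|v x]; last exact: cst_continuous.
pose L := fun N : 'cV[R]_k => N i 0.
have L1 : linear L by move=> a u v; rewrite /L !mxE.
pose HL := GRing.isLinear.Build _ _ _ _ _ L1.
pose f : {linear 'cV[R]_k -> R} := HB.pack L HL.
have cf : continuous f by exact: coord_continuous.
have -> : (fun x : 'cV[R]_k => x i 0) = f by [].
apply: DiffDef; first exact: linear_differentiable.
by rewrite diff_lin.
Qed.

Lemma C1_D f df g dg : C1_with f df -> C1_with g dg ->
  C1_with (fun x => f x + g x) (fun x v => df x v + dg x v).
Proof.
move=> [fd fc] [gd gc]; split=> [x|v x]; first exact: is_diffD.
by apply: continuousD; [exact: fc|exact: gc].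
Qed.

Lemma C1_M f df g dg : C1_with f df -> C1_with g dg ->
  C1_with (fun x => f x * g x) (fun x v => df x v * g x + f x * dg x v).
Proof.
move=> fC gC; have [fd fc] := fC; have [gd gc] := gC; split=> [x|v x].
  apply: (is_diff_eq (is_diffM (fd x) (gd x))).
  by apply/funext => v; rewrite /= addrC mulrC.
apply: (@continuousD _ _ _ (fun x => df x v * g x) (fun x => f x * dg x v));
  apply: continuousM.
- exact: fc.
- exact: (C1_continuous gC).
- exact: (C1_continuous fC).
- exact: gc.
Qed.

Lemma C1_Z c f df : C1_with f df ->
  C1_with (fun x => c * f x) (fun x v => c * df x v).
Proof.
by move/(C1_M (C1_cst c))/C1_ext; apply=> // x v; rewrite mul0r add0r.
Qed.

Lemma C1_N f df : C1_with f df -> C1_with (fun x => - f x) (fun x v => - df x v).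
Proof. by move/(C1_Z (-1))/C1_ext; apply=> *; rewrite mulN1r. Qed.

Lemma C1_B f df g dg : C1_with f df -> C1_with g dg ->
  C1_with (fun x => f x - g x) (fun x v => df x v - dg x v).
Proof. by move=> fC /C1_N; exact: C1_D. Qed.

Lemma C1_sum (I : Type) (r : seq I) (f : I -> 'cV[R]_k -> R)
    (df : I -> 'cV[R]_k -> 'cV[R]_k -> R) :
  (forall i, C1_with (f i) (df i)) ->
  C1_with (fun x => \sum_(i <- r) f i x) (fun x v => \sum_(i <- r) df i x v).
Proof.
move=> fC; elim: r => [|i r IH].
  by apply: (C1_ext (C1_cst 0)) => *; rewrite big_nil.
by apply: (C1_ext (C1_D (fC i) IH)) => *; rewrite big_cons.
Qed.

Lemma is_diff_cos (y : R) : is_diff y cos (fun h => h * - sin y).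
Proof.
have [dc dcE] := is_derive_cos y; apply: DiffDef.
  exact/derivable1_diffP.
by rewrite deriv1E//; apply/funext => h; rewrite derive1E dcE.
Qed.

Lemma C1_cos f df : C1_with f df ->
  C1_with (fun x => cos (f x)) (fun x v => df x v * - sin (f x)).
Proof.
move=> fC; have [fd fc] := fC; split=> [x|v x].
  exact: (is_diff_comp (fd x) (is_diff_cos (f x))).
apply: (@continuousM _ _ (df^~ v) (fun x => - sin (f x))); first exact: fc.
apply: (@continuousN _ _ _ (fun x => sin (f x))).
apply: (@continuous_comp _ _ _ f sin).
  exact: (C1_continuous fC).
exact: continuous_sin.
Qed.

Lemma C1v_mulmx (l l' : nat) (A : 'M[R]_(l', l)) (F : 'cV[R]_k -> 'cV[R]_l) dF :
  C1v_with F dF -> C1v_with (fun x => A *m F x) (fun x v => A *m dF x v).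
Proof.
move=> FC i; apply: (C1_ext (C1_sum (index_enum _) (fun j => C1_Z (A i j) (FC j)))) => *;
  by rewrite mxE.
Qed.

Lemma C1v_cst (l : nat) (c : 'cV[R]_l) : C1v_with (fun _ : 'cV[R]_k => c) (fun _ _ => 0).
Proof. by move=> i; apply: (C1_ext (C1_cst (c i 0))) => // *; rewrite mxE. Qed.

Lemma C1v_B (l : nat) (F G : 'cV[R]_k -> 'cV[R]_l) dF dG :
  C1v_with F dF -> C1v_with G dG ->
  C1v_with (fun x => F x - G x) (fun x v => dF x v - dG x v).
Proof.
by move=> FC GC i; apply: (C1_ext (C1_B (FC i) (GC i))) => *; rewrite !mxE.
Qed.

Lemma C1v_Bcst (l : nat) (F : 'cV[R]_k -> 'cV[R]_l) dF c :
  C1v_with F dF -> C1v_with (fun x => F x - c) dF.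
Proof.
move=> FC i; apply: (C1_ext (C1v_B FC (C1v_cst c) i)) => // x v.
by rewrite subr0.
Qed.

Lemma C1v_id : C1v_with (fun x : 'cV[R]_k => x) (fun _ v => v).
Proof. exact: C1_coord. Qed.

Lemma C1_dot (l : nat) (F G : 'cV[R]_k -> 'cV[R]_l) dF dG :
  C1v_with F dF -> C1v_with G dG ->
  C1_with (fun x => dot (F x) (G x))
    (fun x v => dot (dF x v) (G x) + dot (F x) (dG x v)).
Proof.
move=> FC GC.
apply: (C1_ext (C1_sum (index_enum _) (fun j => C1_M (FC j) (GC j)))) => *.
  exact: dotE.
by rewrite !dotE big_split.
Qed.

Lemma C1v_cos (l : nat) (F : 'cV[R]_k -> 'cV[R]_l) dF :
  C1v_with F dF -> C1v_with (fun x => map_mx cos (F x))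
    (fun x v => \col_i (dF x v i 0 * - sin (F x i 0))).
Proof. by move=> FC i; apply: (C1_ext (C1_cos (FC i))) => *; rewrite !mxE. Qed.

Lemma C1_gradient f df : C1_with f df ->
  forall x v, dot (gradient f x) v = df x v.
Proof.
move=> [fd _] x v; have [dfx <-] := fd x; rewrite dotE.
under eq_bigr => i _ do rewrite mxE deriveE// mulrC.
rewrite [in RHS](_ : v = \sum_i v i 0 *: delta_mx i 0); last first.
  by rewrite [LHS]matrix_sum_delta; apply: eq_bigr => i _; rewrite big_ord1.
by rewrite linear_sum; apply: eq_bigr => i _; rewrite linearZ.
Qed.

Lemma C1_continuously_differentiable f df :
  C1_with f df -> continuously_differentiable f.
Proof.
move=> fC; have [fd fc] := fC; split=> [x|]; first by have [] := fd x.
have -> : gradient f = fun x => \sum_i df x (delta_mx i 0) *: delta_mx i 0.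
  apply/funext => x; rewrite [LHS]matrix_sum_delta; apply: eq_bigr => i _.
  rewrite big_ord1 -(C1_gradient fC); congr (_ *: _).
  rewrite dotE (bigD1 i)//= big1 => [|j /negPf ji].
    by rewrite [delta_mx _ _ _ _]mxE !eqxx mulr1 addr0.
  by rewrite [delta_mx _ _ _ _]mxE ji mulr0.
apply: continuous_big => [|i _]; first exact: add_continuous.
move=> x; apply: (@continuous_comp _ _ _ (df^~ (delta_mx i 0))
  (fun a : R => a *: (delta_mx i 0 : 'cV[R]_k))); first exact: fc.
exact: scalel_continuous.
Qed.

End C1Theory.

(** * Scalar inequalities *)

(** Writing the intermediate point as [t + r * (s - t)] covers both orders of [s] and [t], and
    equality, without case distinctions in the applications. *)
Lemma mean_value (R : realType) (f df : R -> R) (s t : R) :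
  (forall x : R, is_derive x (1 : R) f (df x)) ->
  exists2 r, 0 <= r <= 1 & f s - f t = df (t + r * (s - t)) * (s - t).
Proof.
move=> fd.
have MV a b : a < b -> exists2 r, 0 <= r <= 1 &
    f b - f a = df (a + r * (b - a)) * (b - a).
  move=> ab; have cf : {within `[a, b], continuous f}.
    apply: derivable_within_continuous => x _.
    by have [] := fd x.
  have [x + fab] := MVT ab (fun x _ => fd x) cf.
  rewrite in_itv/= => /andP[ax xb].
  have ba0 : 0 < b - a by rewrite subr_gt0.
  exists ((x - a) / (b - a)).
    rewrite ler_pdivrMr// mul1r lerD2r (ltW xb) andbT.
    by rewrite divr_ge0 ?subr_ge0// ltW.
  by rewrite divfK ?gt_eqF// [a + _]addrC subrK.
have [/MV[r r01 E]|/MV[r r01 E]|->] := ltgtP t s.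
- by exists r.
- exists (1 - r); first by move/andP: r01 => [? ?]; apply/andP; split; lra.
  rewrite (_ : t + (1 - r) * (s - t) = s + r * (t - s)); last by ring.
  by rewrite -opprB E; ring.
- by exists 0; [rewrite lexx ler01|rewrite !subrr mulr0].
Qed.

Lemma sin_lipschitz (R : realType) (s t : R) : `|sin s - sin t| <= `|s - t|.
Proof.
have [r _ ->] := mean_value s t (@is_derive_sin R).
rewrite normrM ler_piMl// ler_norml cos_geN1 cos_le1//.
Qed.

Lemma cos_ge_cos_bound (R : realType) (g x : R) :
  - g <= x <= g -> g < pi / 2 -> cos g <= cos x.
Proof.
move=> /andP[gx xg] gp.
have pi0 := pi_gt0 R.
have nonneg y : 0 <= y -> y <= g -> cos g <= cos y.
  move=> y0 yg; rewrite leNgt ltr_cos ?in_itv/= -?leNgt//; apply/andP; split; lra.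
have [x0|x0] := leP 0 x; first exact: nonneg.
by rewrite -(cosN x); apply: nonneg; lra.
Qed.

Section SineSector.
Variables (R : realType) (g s t : R).
Hypotheses (gp : g < pi / 2) (sg : - g <= s <= g) (tg : - g <= t <= g).

(** The intermediate point lies between [s] and [t], hence in [[-g, g]], where the derivative of
    sine is at least [cos g]. *)
Lemma sin_strongly_monotone :
  cos g * (s - t) ^+ 2 <= (s - t) * (sin s - sin t).
Proof.
have [r /andP[r0 r1] ->] := mean_value s t (@is_derive_sin R).
have -> (u : R) : (s - t) * (u * (s - t)) = u * (s - t) ^+ 2 by ring.
rewrite ler_wpM2r ?sqr_ge0// cos_ge_cos_bound//.
move: sg tg => /andP[? ?] /andP[? ?]; apply/andP; split; nra.
Qed.

End SineSector.

Section CosineBregman.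
Variables (R : realType) (g s t : R).
Hypotheses (gp : g < pi / 2) (sg : - g <= s <= g) (tg : - g <= t <= g).

(** The left side is the Bregman distance of [- cos]. The mean value theorem turns it into a
    difference of sines times [s - t], and sine is 1-Lipschitz. *)
Lemma cos_bregman_upper : cos t - cos s - (s - t) * sin t <= (s - t) ^+ 2.
Proof.
have [r /andP[r0 r1] E] := mean_value s t (@is_derive_cos R).
have -> : cos t - cos s - (s - t) * sin t
    = (sin (t + r * (s - t)) - sin t) * (s - t).
  by rewrite -(opprB (cos s)) E; ring.
rewrite (le_trans (ler_norm _))// normrM.
have := sin_lipschitz (t + r * (s - t)) t.
rewrite addrAC subrr add0r normrM (ger0_norm r0) => H.
rewrite -real_normK ?num_real// expr2 ler_wpM2r// (le_trans H)//.
by rewrite ler_piMl.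
Qed.

(** Up to constants, [h] is the right side minus the left side as a function of [s]. On [[-g, g]]
    strong monotonicity of sine makes its derivative nonnegative above [t] and nonpositive below, so
    it is smallest at [t]. *)
Lemma cos_bregman_lower :
  cos g / 2 * (s - t) ^+ 2 <= cos t - cos s - (s - t) * sin t.
Proof.
pose h u := - cos u - u * sin t - cos g / 2 * (u - t) ^+ 2.
have hd (u : R) : is_derive u (1 : R) h (sin u - sin t - cos g * (u - t)).
  rewrite /h; apply: is_derive_eq.
  by rewrite /GRing.scale/=; field.
have [r /andP[r0 r1]] := mean_value s t hd.
set x := t + r * (s - t) => E.
suff : 0 <= h s - h t by rewrite /h subrr expr0n/=; lra.
rewrite E; move: r0; rewrite le_eqVlt => /predU1P[r0|r0].
  by rewrite /x -r0 mul0r addr0 !subrr mulr0 subr0 mul0r.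
(* Multiplying by [r] turns [s - t] into [x - t], so that strong monotonicity applies to the pair
   [x], [t]. *)
rewrite -(pmulr_rge0 _ r0).
have xg : - g <= x <= g.
  by move: sg tg => /andP[? ?] /andP[? ?]; apply/andP; split; rewrite /x; nra.
have := sin_strongly_monotone gp xg tg.
have -> : r * ((sin x - sin t - cos g * (x - t)) * (s - t))
   = (x - t) * (sin x - sin t) - cos g * (x - t) ^+ 2 by rewrite /x; ring.
lra.
Qed.

End CosineBregman.

Lemma class_Kinfty_linear (R : realType) (c : R) : 0 < c ->
  class_Kinfty (fun r => c * r).
Proof.
move=> c0; split.
- by rewrite mulr0.
- by apply: continuous_subspaceT => x; exact: mulrl_continuous.
- by move=> x y _ _ xy; rewrite ltr_pM2l.
- apply/cvgryPge => A; near=> x.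
  have xA : A / c <= x by near: x; apply: nbhs_pinfty_ge; exact: num_real.
  by rewrite mulrC -ler_pdivrMr.
Unshelve. all: by end_near. Qed.

Lemma class_Kinfty_square (R : realType) (c : R) : 0 < c ->
  class_Kinfty (fun r => c * r ^+ 2).
Proof.
move=> c0; split.
- by rewrite expr0n mulr0.
- apply: continuous_subspaceT => x.
  apply: (@continuous_comp _ _ _ (fun r : R => r ^+ 2) (fun r => c * r)).
    exact: exprn_continuous.
  exact: mulrl_continuous.
- move=> x y; rewrite !in_itv/= !andbT => x0 y0 xy.
  by rewrite ltr_pM2l// ltr_sqr.
- apply/cvgryPge => A; near=> x.
  have x1 : 1 <= x by near: x; apply: nbhs_pinfty_ge; exact: num_real.
  have xA : A / c <= x by near: x; apply: nbhs_pinfty_ge; exact: num_real.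
  by rewrite -ler_pdivrMl// mulrC (le_trans xA)// expr2 ler_peMl// (le_trans _ x1).
Unshelve. all: by end_near. Qed.

(** The constants come from completing a square: [x] takes a quarter of the available decay [c], at
    the price [K ^+ 2 / c] on [y]. *)
Lemma young (R : realFieldType) (c K x y : R) : 0 < c ->
  K * (x * y) <= c / 4 * x ^+ 2 + K ^+ 2 / c * y ^+ 2.
Proof.
move=> c0; rewrite -subr_ge0 -(pmulr_rge0 _ c0).
have -> : c * (c / 4 * x ^+ 2 + K ^+ 2 / c * y ^+ 2 - K * (x * y))
  = (c / 2 * x - K * y) ^+ 2 by field; rewrite gt_eqF.
exact: sqr_ge0.
Qed.

(* [delta] lets the [- c p^2] of the second cross term absorb the positive
   [p^2] of the other two; [e] then lets the genuine dissipation in [w], [b]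
   absorb everything that is left. *)
Lemma hierarchical_dissipation (R : realFieldType) (c K e1 : R) :
  0 < c -> 0 < K -> 0 < e1 ->
  exists delta e alpha,
    [/\ 0 < delta <= 1, 0 < e <= e1, 0 < alpha & forall a w b p l : R,
    - c * w ^+ 2 - c * b ^+ 2
    + e * (delta * (- c * a ^+ 2 + K * (w ^+ 2 + a * w + a * p))
           + (- c * p ^+ 2 + K * (b * p + b * l + b ^+ 2 + b * w))
           + delta * (- c * l ^+ 2 + K * (p ^+ 2 + l * b + l * p + l * w)))
    <= - alpha * (a ^+ 2 + w ^+ 2 + b ^+ 2 + p ^+ 2 + l ^+ 2)].
Proof.
move=> c0 K0 e10.
pose k := K ^+ 2 / c.
have k0 : 0 < k by rewrite divr_gt0// exprn_gt0.
have m0 : 0 < c + 4 * (3 * k + K) by lra.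
(* The terms weighted by [delta] charge [3 * k + K] to [p ^+ 2]: [k] from [a * p], [2 * k] from
   [l * p] and [K] directly. This choice keeps the charge below [c / 4]; [h3] takes another
   [c / 4]. *)
pose delta := c / (c + 4 * (3 * k + K)).
have d0 : 0 < delta by rewrite divr_gt0.
have d1 : delta <= 1 by rewrite ler_pdivrMr// mul1r; lra.
have dE : delta * (3 * k + K) <= c / 4.
  by rewrite mulrAC ler_pdivrMr//; nra.
(* [S] dominates the coefficients of [w ^+ 2] and [b ^+ 2] that the cross terms produce, as
   collected in [hw] and [hb]. *)
pose S := 4 * K + 6 * k + 2 * (k / delta).
have kd0 : 0 < k / delta by rewrite divr_gt0.
have S0 : 0 < S by rewrite /S; lra.
(* The cross terms may consume half of the dissipation in [w] and [b]. *)
pose e := Num.min e1 (c / 2 / S).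
have e0 : 0 < e by rewrite lt_min e10 !divr_gt0.
have eS : e * S <= c / 2 by rewrite -ler_pdivlMr// ge_min lexx orbT.
pose alpha := Num.min (c / 2) (e * delta * (c / 2)).
exists delta, e, alpha; split.
- by rewrite d0.
- by rewrite e0 ge_min lexx.
- by rewrite lt_min !mulr_gt0// invr_gt0.
move=> a w b p l.
have al1 : alpha <= c / 2 by rewrite ge_min lexx.
have al2 : alpha <= e * delta * (c / 2) by rewrite ge_min lexx orbT.
have c20 : 0 < c / 2 by rewrite divr_gt0.
have c20' := ltW c20.
(* Four mixed terms draw on the decay in [l]; each takes [c / 8], up to the factor [delta], and half
   of it remains. *)
have Y2 x y : K * (x * y) <= c / 8 * x ^+ 2 + 2 * k * y ^+ 2.
  have := young K x y c20; rewrite /k.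
  have -> : K ^+ 2 / (c / 2) = 2 * (K ^+ 2 / c) by field; rewrite gt_eqF.
  lra.
have h1 : delta * (K * (a * w)) <= delta * (c / 4 * a ^+ 2 + k * w ^+ 2).
  by rewrite ler_wpM2l ?(ltW d0)//; exact: young.
have h2 : delta * (K * (a * p)) <= delta * (c / 4 * a ^+ 2 + k * p ^+ 2).
  by rewrite ler_wpM2l ?(ltW d0)//; exact: young.
have h3 := young K p b c0; rewrite -/k in h3.
(* This term comes from the second cross term, which has no factor [delta], while the decay in [l]
   has one. Young's inequality with weight [delta * c / 2] therefore puts [k / delta] on
   [b ^+ 2]. *)
have h4 : K * (l * b) <= delta * c / 8 * l ^+ 2 + 2 * (k / delta) * b ^+ 2.
  have dc0 : 0 < delta * c / 2 by rewrite divr_gt0 ?(mulr_gt0 d0 c0).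
  have := young K l b dc0; rewrite /k.
  have -> : K ^+ 2 / (delta * c / 2) = 2 * (K ^+ 2 / c / delta).
    by field; rewrite !gt_eqF.
  lra.
have h5 : K * (b * w) <= K * (b ^+ 2 + w ^+ 2).
  by rewrite ler_wpM2l ?(ltW K0)//; have := sqr_ge0 (b - w); have := sqr_ge0 (b + w);
    rewrite !expr2; nra.
have h6 : delta * (K * (l * b)) <= delta * (c / 8 * l ^+ 2 + 2 * k * b ^+ 2).
  by rewrite ler_wpM2l ?(ltW d0).
have h7 : delta * (K * (l * p)) <= delta * (c / 8 * l ^+ 2 + 2 * k * p ^+ 2).
  by rewrite ler_wpM2l ?(ltW d0).
have h8 : delta * (K * (l * w)) <= delta * (c / 8 * l ^+ 2 + 2 * k * w ^+ 2).
  by rewrite ler_wpM2l ?(ltW d0).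
have a2 := sqr_ge0 a; have w2 := sqr_ge0 w; have b2 := sqr_ge0 b.
have p2 := sqr_ge0 p; have l2 := sqr_ge0 l.
have hp : delta * (3 * k + K) * p ^+ 2 <= c / 4 * p ^+ 2 by rewrite ler_wpM2r.
have dk : delta * k <= k by rewrite ler_piMl// ltW.
have dK : delta * K <= K by rewrite ler_piMl// ltW.
have hw : (delta * K + 3 * (delta * k) + K) * w ^+ 2 <= S * w ^+ 2.
  by rewrite ler_wpM2r// /S; lra.
have hb : (2 * K + k + 2 * (k / delta) + 2 * (delta * k)) * b ^+ 2 <= S * b ^+ 2.
  by rewrite ler_wpM2r// /S; lra.
set X := (X in e * X).
have hX : X <= - (delta * (c / 2)) * a ^+ 2 - c / 2 * p ^+ 2
             - delta * (c / 2) * l ^+ 2 + S * (w ^+ 2 + b ^+ 2).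
  have : 0 <= K * b ^+ 2 by rewrite mulr_ge0 // ltW.
  rewrite /X; lra.
have {}hX : e * X <= e * (- (delta * (c / 2)) * a ^+ 2 - c / 2 * p ^+ 2
             - delta * (c / 2) * l ^+ 2 + S * (w ^+ 2 + b ^+ 2)).
  by rewrite ler_wpM2l// ltW.
have hS : e * S * (w ^+ 2 + b ^+ 2) <= c / 2 * (w ^+ 2 + b ^+ 2).
  by rewrite ler_wpM2r// addr_ge0.
have hc : e * delta * (c / 2) * p ^+ 2 <= e * (c / 2) * p ^+ 2.
  by rewrite ler_wpM2r// -mulrA ler_wpM2l ?(ltW e0)// ger_pMl.
have g1 : alpha * (a ^+ 2 + p ^+ 2 + l ^+ 2) <=
  e * delta * (c / 2) * (a ^+ 2 + p ^+ 2 + l ^+ 2).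
  by rewrite ler_wpM2r// !addr_ge0.
have g2 : alpha * (w ^+ 2 + b ^+ 2) <= c / 2 * (w ^+ 2 + b ^+ 2).
  by rewrite ler_wpM2r// addr_ge0.
lra.
Qed.

(** * The potential and the closed loop in deviations *)

Section Potential.
Variables (R : realType) (n m : nat) (N : bidding_network R n m).
Hypothesis hS : standing_assumptions N.

Lemma Gamma_gt0 k : 0 < Gamma N k k.
Proof.
rewrite !mxE eqxx mulr1n.
have ek := (edge_labelled hS).1 k.
by rewrite !mulr_gt0 ?(susceptance_gt0 hS ek) ?(voltage_gt0 hS).
Qed.

Lemma dot_ones_Gamma v :
  dot (ones R m) (Gamma N *m v) = \sum_k Gamma N k k * v k 0.
Proof.
rewrite dotE; apply: eq_bigr => k _; rewrite /Gamma mul_diag_mx !mxE.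
by rewrite eqxx mulr1n mul1r.
Qed.

Lemma potentialE phi :
  potential N phi = - \sum_k Gamma N k k * cos (line_angles N phi k 0).
Proof.
rewrite /potential dot_ones_Gamma; congr (- _); apply: eq_bigr => k _.
by rewrite [map_mx _ _ _ _]mxE.
Qed.

Lemma line_anglesB phi psi :
  line_angles N (phi - psi) = line_angles N phi - line_angles N psi.
Proof. by rewrite /line_angles !mulmxBr. Qed.

Lemma coord_line_anglesB phi psi k :
  line_angles N (phi - psi) k 0 = line_angles N phi k 0 - line_angles N psi k 0.
Proof.
rewrite line_anglesB; move: (line_angles N phi) (line_angles N psi) => u v.
by rewrite !mxE.
Qed.

(** The inner map [F] is the identity for the gradient of [U] and [st_phi] for the Lyapunov
    function. *)
Lemma C1_potential (l : nat) (F : 'cV[R]_l -> 'cV[R]_(n.-1)) dF :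
  C1v_with F dF ->
  C1_with (fun x => potential N (F x))
    (fun x v => \sum_k Gamma N k k *
      (line_angles N (dF x v) k 0 * sin (line_angles N (F x) k 0))).
Proof.
move=> FC.
have HC := C1v_mulmx (Dinc N)^T (C1v_mulmx (Dtree_pinv N)^T FC).
have GC := C1v_mulmx (Gamma N) (C1v_cos HC).
apply: (C1_ext (C1_N (C1_dot (C1v_cst _ (ones R m)) GC))) => // x v.
rewrite dot0l add0r dot_ones_Gamma -sumrN; apply: eq_bigr => k _.
by rewrite [(\col__ _) _ _]mxE -!mulrN opprK.
Qed.

Lemma dot_gradient_potential phi v :
  dot (gradient (potential N) phi) v =
  \sum_k Gamma N k k * (line_angles N v k 0 * sin (line_angles N phi k 0)).
Proof. by have := C1_gradient (C1_potential (@C1v_id R n.-1)) phi v. Qed.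

End Potential.

(** * Coordinates of the state *)

Section StateTheory.
Variables (R : realType) (n : nat).
Implicit Types x v : 'cV[R]_(state_dim n).

Lemma C1v_st_phi : C1v_with (@st_phi R n) (fun _ v => st_phi v).
Proof. by move=> i; apply: (C1_ext (C1_coord R _)) => *; rewrite mxE. Qed.

Lemma C1v_st_omega : C1v_with (@st_omega R n) (fun _ v => st_omega v).
Proof. by move=> i; apply: (C1_ext (C1_coord R _)) => *; rewrite !mxE. Qed.

Lemma C1v_st_b : C1v_with (@st_b R n) (fun _ v => st_b v).
Proof. by move=> i; apply: (C1_ext (C1_coord R _)) => *; rewrite !mxE. Qed.

Lemma C1v_st_Pg : C1v_with (@st_Pg R n) (fun _ v => st_Pg v).
Proof. by move=> i; apply: (C1_ext (C1_coord R _)) => *; rewrite !mxE. Qed.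

Lemma C1_st_lambda : C1_with (@st_lambda R n) (fun _ v => st_lambda v).
Proof. by apply: (C1_ext (C1_coord R _)) => *; rewrite /st_lambda !mxE. Qed.

Lemma st_phiB x v : st_phi (x - v) = st_phi x - st_phi v.
Proof. exact: linearB. Qed.

Lemma st_omegaB x v : st_omega (x - v) = st_omega x - st_omega v.
Proof. by rewrite /st_omega !linearB. Qed.

Lemma st_bB x v : st_b (x - v) = st_b x - st_b v.
Proof. by rewrite /st_b !linearB. Qed.

Lemma st_PgB x v : st_Pg (x - v) = st_Pg x - st_Pg v.
Proof. by rewrite /st_Pg !linearB. Qed.

Lemma st_lambdaB x v : st_lambda (x - v) = st_lambda x - st_lambda v.
Proof. by rewrite /st_lambda !linearB !mxE. Qed.

Lemma col_state_st x :
  col_state (st_phi x) (st_omega x) (st_b x) (st_Pg x) (st_lambda x) = x.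
Proof.
rewrite /col_state /st_phi /st_omega /st_b /st_Pg /st_lambda.
by rewrite -mx11_scalar !vsubmxK.
Qed.

Lemma enorm_state x :
  enorm x ^+ 2 = enorm (st_phi x) ^+ 2 + enorm (st_omega x) ^+ 2
    + enorm (st_b x) ^+ 2 + enorm (st_Pg x) ^+ 2 + st_lambda x ^+ 2.
Proof.
rewrite !enorm_sqr -{1 2}(col_state_st x) /col_state !dot_col_mx !addrA.
by congr (_ + _); rewrite dotE big_ord1 !mxE eqxx mulr1n expr2.
Qed.

Variables (phi : 'cV[R]_(n.-1)) (omega b Pg : 'cV[R]_n) (lambda : R).
Let y := col_state phi omega b Pg lambda.

Lemma col_state_phi : st_phi y = phi. Proof. exact: col_mxKu. Qed.

Lemma col_state_omega : st_omega y = omega.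
Proof. by rewrite /st_omega col_mxKd col_mxKu. Qed.

Lemma col_state_b : st_b y = b.
Proof. by rewrite /st_b !col_mxKd col_mxKu. Qed.

Lemma col_state_Pg : st_Pg y = Pg.
Proof. by rewrite /st_Pg !col_mxKd col_mxKu. Qed.

Lemma col_state_lambda : st_lambda y = lambda.
Proof. by rewrite /st_lambda !col_mxKd mxE eqxx mulr1n. Qed.

End StateTheory.

(** * The closed loop around its equilibrium *)

Section ClosedLoop.
Variables (R : realType) (n m : nat) (N : bidding_network R n m).
Hypothesis hS : standing_assumptions N.
Variable xbar : 'cV[R]_(state_dim n).
Hypothesis hxbar : closed_loop N xbar = 0.
Implicit Types x v : 'cV[R]_(state_dim n).

Let M := inertia N.
Let grad := gradient (potential N).

Let M_unit : M \in unitmx.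
Proof. by case: (positive_diagonal_inv (inertia_pos hS)). Qed.

Lemma Tb_positive_diagonal : positive_diagonal (Tb N).
Proof. exact: (positive_definite_diagonal (Tb_diag hS) (Tb_posdef hS)). Qed.

Lemma Tg_positive_diagonal : positive_diagonal (Tg N).
Proof. exact: (positive_definite_diagonal (Tg_diag hS) (Tg_posdef hS)). Qed.

Lemma Qmx_positive_diagonal : positive_diagonal (Qmx N).
Proof.
split; first exact: diag_mx_is_diag.
by move=> i; rewrite !mxE eqxx mulr1n (qcost_gt0 hS).
Qed.

Let Tb_unit : Tb N \in unitmx.
Proof. by case: (positive_diagonal_inv Tb_positive_diagonal). Qed.

Let Tg_unit : Tg N \in unitmx.
Proof. by case: (positive_diagonal_inv Tg_positive_diagonal). Qed.

Lemma closed_loop_phi x :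
  st_phi (closed_loop N x) = (Dtree N)^T *m st_omega x.
Proof. exact: col_state_phi. Qed.

Lemma closed_loop_omega x :
  M *m st_omega (closed_loop N x) =
  - (Dtree N *m grad (st_phi x)) - damping N *m st_omega x + st_Pg x - load N.
Proof. by rewrite col_state_omega mulKVmx. Qed.

Lemma closed_loop_b x :
  Tb N *m st_b (closed_loop N x) =
  st_Pg x - invmx (Qmx N) *m st_b x + invmx (Qmx N) *m ccost N.
Proof. by rewrite col_state_b mulKVmx. Qed.

Lemma closed_loop_Pg x :
  Tg N *m st_Pg (closed_loop N x) =
  st_lambda x *: ones R n - st_b x
  + rho N *: (ones R n *m (ones R n)^T *m (load N - st_Pg x))
  - sigma N ^+ 2 *: st_omega x.
Proof. by rewrite col_state_Pg mulKVmx. Qed.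

Lemma closed_loop_lambda x :
  tau N * st_lambda (closed_loop N x) = dot (ones R n) (load N - st_Pg x).
Proof. by rewrite col_state_lambda mulVKf// gt_eqF// (tau_gt0 hS). Qed.

(* [omegabar] is constant along the tree; pairing the swing equation with
   [ones] then leaves only its damping term. *)
Lemma equilibrium_omega : st_omega xbar = 0.
Proof.
set w := st_omega xbar.
have Dw : w^T *m Dtree N = 0.
  apply: trmx_inj; rewrite trmx_mul trmxK -closed_loop_phi hxbar trmx0.
  by rewrite /st_phi linear0.
have [se _ ce _] := tree_spanning hS.
have cst := incidence_ker se ce (tree_labelled hS) Dw.
have i0 : 'I_n := Ordinal (edge_connected hS).1.
have wE : w = w i0 0 *: ones R n.
  by apply/colP => i; have := cst i i0; rewrite !mxE mulr1.
(* At rest the equation for [lambda] says that total generation equals total load. *)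
have balance : dot (ones R n) (load N - st_Pg xbar) = 0.
  by rewrite -closed_loop_lambda hxbar /st_lambda !linear0 mxE mulr0.
have := congr1 (dot (ones R n)) (closed_loop_omega xbar).
rewrite hxbar [st_omega 0](_ : _ = 0); last by rewrite /st_omega !linear0.
rewrite mulmx0 dot0r -addrA -[st_Pg xbar - _]opprB 2!dotDr !dotNr.
rewrite balance subr0 {1}/dot mulmxA (ones_Dtree hS) mul0mx mxE oppr0 add0r.
rewrite -/w wE -scalemxAr dotZr => /eqP.
rewrite eq_sym oppr_eq0 mulf_eq0 => /orP[/eqP->|/eqP A0]; first by rewrite scale0r.
have [c c0 /(_ (ones R n))] := positive_diagonal_coercive (damping_pos hS).
rewrite A0 pmulr_rle0// => /(conj (dot_ge0 (ones R n)))/andP.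
rewrite -eq_le eq_sym => /eqP/dot_eq0 o0.
by move/colP/(_ i0): o0 => /eqP; rewrite !mxE oner_eq0.
Qed.

Section Deviations.
Variable x : 'cV[R]_(state_dim n).
Let f := closed_loop N x.
Let w := st_omega x.
Let b := st_b (x - xbar).
Let p := st_Pg (x - xbar).
Let l := st_lambda (x - xbar).
Let g := grad (st_phi x) - grad (st_phi xbar).

(** Subtracting the equilibrium equation removes the constant load; the three lemmas that follow
    treat the other components likewise. *)
Lemma deviation_omega : M *m st_omega f = - (Dtree N *m g) - damping N *m w + p.
Proof.
have := closed_loop_omega xbar; rewrite hxbar equilibrium_omega.
rewrite [st_omega 0](_ : _ = 0); last by rewrite /st_omega !linear0.
have -> : Dtree N *m g =
    Dtree N *m grad (st_phi x) - Dtree N *m grad (st_phi xbar).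
  by rewrite mulmxBr.
rewrite closed_loop_omega /p st_PgB -/w !mulmx0.
(* The products are made opaque so that [mxE] leaves a linear identity between entries instead of
   unfolding them into sums. *)
generalize (Dtree N *m grad (st_phi x)) (Dtree N *m grad (st_phi xbar)).
generalize (damping N *m w) (st_Pg x) (st_Pg xbar) (load N).
move=> d px pbar ld u v E.
apply/colP => i; have /colP/(_ i) := E; rewrite !mxE => Ei; lra.
Qed.

Lemma deviation_b : Tb N *m st_b f = p - invmx (Qmx N) *m b.
Proof.
have := closed_loop_b xbar; rewrite hxbar.
rewrite [st_b 0](_ : _ = 0); last by rewrite /st_b !linear0.
have -> : invmx (Qmx N) *m b =
    invmx (Qmx N) *m st_b x - invmx (Qmx N) *m st_b xbar.
  by rewrite /b st_bB mulmxBr.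
rewrite closed_loop_b /p st_PgB mulmx0.
generalize (invmx (Qmx N) *m st_b x) (invmx (Qmx N) *m st_b xbar).
generalize (invmx (Qmx N) *m ccost N) (st_Pg x) (st_Pg xbar) => d px pbar u v E.
apply/colP => i; have /colP/(_ i) := E; rewrite !mxE => Ei; lra.
Qed.

Lemma deviation_Pg : Tg N *m st_Pg f =
  l *: ones R n - b - (rho N * dot (ones R n) p) *: ones R n
  - sigma N ^+ 2 *: w.
Proof.
have oo u : ones R n *m (ones R n)^T *m u = dot (ones R n) u *: ones R n.
  by rewrite -mulmxA [_^T *m u]mx11_scalar mul_mx_scalar.
have := closed_loop_Pg xbar; rewrite hxbar equilibrium_omega.
rewrite [st_Pg 0](_ : _ = 0); last by rewrite /st_Pg !linear0.
rewrite closed_loop_Pg /p /b /l st_PgB st_bB st_lambdaB !oo mulmx0 !dotDr !dotNr.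
rewrite -/w; move: (dot _ (load N)) (dot _ (st_Pg x)) (dot _ (st_Pg xbar)).
move=> d1 d2 d3; generalize (st_b x) (st_b xbar) w => bx bbar w' E.
apply/colP => i; have /colP/(_ i) := E; rewrite !mxE => Ei; lra.
Qed.

Lemma deviation_lambda : tau N * st_lambda f = - dot (ones R n) p.
Proof.
have := closed_loop_lambda xbar; rewrite hxbar.
rewrite [st_lambda 0](_ : _ = 0); last by rewrite /st_lambda !linear0 mxE.
rewrite closed_loop_lambda /p st_PgB !dotDr !dotNr; lra.
Qed.

End Deviations.

(** The derivative of [Weps] at [x] in direction [v]. Where possible, [M], [Tb], [Tg] and [tau] are
    moved onto the components of [v], so that the deviation equations substitute directly when [v]
    is the vector field. *)
Definition dWeps (e0 e1 e2 e3 : R) x v : R :=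
  dot (grad (st_phi x) - grad (st_phi xbar)) (st_phi v)
  + dot (st_omega x) (M *m st_omega v)
  + (sigma N ^+ 2)^-1 *
      (dot (st_b (x - xbar)) (Tb N *m st_b v)
       + dot (st_Pg (x - xbar)) (Tg N *m st_Pg v)
       + st_lambda (x - xbar) * (tau N * st_lambda v))
  + e0 * e1 *
      (dot (st_phi v) (Dtree_pinv N *m (M *m st_omega x))
       + dot (st_phi (x - xbar)) (Dtree_pinv N *m (M *m st_omega v)))
  - e0 * e2 / sigma N ^+ 2 *
      (dot (st_b v) (Tg N *m st_Pg (x - xbar))
       + dot (st_b (x - xbar)) (Tg N *m st_Pg v))
  - e0 * e3 / sigma N ^+ 2 *
      (st_lambda v * dot (ones R n) (Tg N *m st_Pg (x - xbar))
       + st_lambda (x - xbar) * dot (ones R n) (Tg N *m st_Pg v)).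

Lemma C1_Weps e0 e1 e2 e3 :
  C1_with (Weps N xbar e0 e1 e2 e3) (dWeps e0 e1 e2 e3).
Proof.
have phiC := C1v_Bcst (st_phi xbar) (@C1v_st_phi R n).
have oC := @C1v_st_omega R n.
have bC := C1v_Bcst (st_b xbar) (@C1v_st_b R n).
have pC := C1v_Bcst (st_Pg xbar) (@C1v_st_Pg R n).
have lC := C1_B (@C1_st_lambda R n) (C1_cst _ (st_lambda xbar)).
have TpC := C1v_mulmx (Tg N) pC.
have WC := C1_B (C1_B (C1_D (C1_D (C1_D (C1_B (C1_B
  (C1_potential N (@C1v_st_phi R n))
  (C1_dot phiC (C1v_cst _ (grad (st_phi xbar)))))
  (C1_cst _ (potential N (st_phi xbar))))
  (C1_Z 2^-1 (C1_dot oC (C1v_mulmx M oC))))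
  (C1_Z (2 * sigma N ^+ 2)^-1 (C1_D (C1_D
     (C1_dot bC (C1v_mulmx (Tb N) bC))
     (C1_dot pC TpC)) (C1_Z (tau N) (C1_M lC lC)))))
  (C1_Z (e0 * e1)
     (C1_dot phiC (C1v_mulmx (Dtree_pinv N) (C1v_mulmx M oC)))))
  (C1_Z (e0 * e2 / sigma N ^+ 2) (C1_dot bC TpC)))
  (C1_Z (e0 * e3 / sigma N ^+ 2)
     (C1_M lC (C1_dot (C1v_cst _ (ones R n)) TpC))).
apply: (C1_ext WC) => [x|x v]; first by rewrite /Weps /Vfun /wsqnorm expr2.
rewrite /dWeps -dot_gradient_potential -/grad.
rewrite !dot0l !dot0r st_phiB st_bB st_PgB st_lambdaB.
rewrite (dotC (st_omega v)) (dotC (st_b v) (Tb N *m _)).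
rewrite (dotC (st_Pg v) (Tg N *m _)) !dot_mulmxl.
rewrite (positive_diagonal_trmx (inertia_pos hS)).
rewrite (positive_diagonal_trmx Tb_positive_diagonal).
rewrite (positive_diagonal_trmx Tg_positive_diagonal).
rewrite dotDl dotNl (dotC (st_phi v) (grad _)).
rewrite -/M; have := lt0r_neq0 (sigma_gt0 hS).
repeat match goal with |- context [dot ?u ?v] => generalize (dot u v); intro end.
move: (sigma N) (tau N) (st_lambda x) (st_lambda v) (st_lambda xbar).
by move=> *; field.
Qed.

End ClosedLoop.

(** * Bounds on the potential *)

(** A big-O relation with one constant on all of [D]; its closure rules bound long sums without
    naming their constants. *)
Definition dominated (R : realType) (T : Type) (D : set T) (g f : T -> R) :=
  exists2 C, 0 <= C & forall t, D t -> `|f t| <= C * g t.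

Section Dominated.
Variables (R : realType) (T : Type) (D : set T).
Implicit Types f g : T -> R.

Lemma dominatedD g f1 f2 : dominated D g f1 -> dominated D g f2 ->
  dominated D g (fun t => f1 t + f2 t).
Proof.
move=> [C1 C10 f1P] [C2 C20 f2P]; exists (C1 + C2) => [|t Dt].
  exact: addr_ge0.
rewrite mulrDl (le_trans (ler_normD _ _))// lerD//; [exact: f1P|exact: f2P].
Qed.

Lemma dominatedZ c g f : dominated D g f -> dominated D g (fun t => c * f t).
Proof.
move=> [C C0 fP]; exists (`|c| * C) => [|t Dt]; first exact: mulr_ge0.
by rewrite normrM -mulrA ler_wpM2l// fP.
Qed.

Lemma dominatedB g f1 f2 : dominated D g f1 -> dominated D g f2 ->
  dominated D g (fun t => f1 t - f2 t).
Proof.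
move=> d1 /(dominatedZ (-1)) d2; have [C C0 CP] := dominatedD d1 d2.
by exists C => // t Dt; rewrite -mulN1r CP.
Qed.

Lemma dominated_dot (k l : nat) (N1 N2 : T -> R) (U : T -> 'cV[R]_k)
    (V : T -> 'cV[R]_l) (A : 'M[R]_(k, l)) :
  (forall t, enorm (U t) <= N1 t) -> (forall t, enorm (V t) <= N2 t) ->
  dominated D (fun t => N1 t * N2 t) (fun t => dot (U t) (A *m V t)).
Proof.
move=> UN VN; have [C C0 CP] := dot_mulmx_bound A; exists C => // t _.
by rewrite (le_trans (CP _ _))// ler_wpM2l// ler_pM ?enorm_ge0.
Qed.

Lemma dominated_mul (N1 N2 f1 f2 : T -> R) :
  dominated D N1 f1 -> dominated D N2 f2 ->
  dominated D (fun t => N1 t * N2 t) (fun t => f1 t * f2 t).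
Proof.
move=> [C1 C10 f1P] [C2 C20 f2P]; exists (C1 * C2) => [|t Dt].
  exact: mulr_ge0.
by rewrite normrM mulrACA ler_pM// ?f1P ?f2P.
Qed.

Lemma dominated_dot_cst (k l : nat) (N1 : T -> R) (u : 'cV[R]_k)
    (V : T -> 'cV[R]_l) (A : 'M[R]_(k, l)) :
  (forall t, enorm (V t) <= N1 t) ->
  dominated D N1 (fun t => dot u (A *m V t)).
Proof.
move=> VN; have [C C0 CP] := dot_mulmx_bound A.
exists (C * enorm u) => [|t _]; first by rewrite mulr_ge0 ?enorm_ge0.
by rewrite (le_trans (CP _ _))// mulrA ler_wpM2l ?mulr_ge0 ?enorm_ge0.
Qed.

End Dominated.

Section StateNorms.
Variables (R : realType) (n : nat) (x : 'cV[R]_(state_dim n)).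

Let bound (r : R) : 0 <= r -> r ^+ 2 <= enorm x ^+ 2 -> r <= enorm x.
Proof. by move=> r0; rewrite ler_sqr ?nnegrE ?enorm_ge0. Qed.

Lemma enorm_st_phi : enorm (st_phi x) <= enorm x.
Proof.
apply: bound; rewrite ?enorm_ge0// enorm_state.
rewrite -!addrA lerDl !addr_ge0 ?sqr_ge0//.
Qed.

Lemma enorm_st_omega : enorm (st_omega x) <= enorm x.
Proof.
apply: bound; rewrite ?enorm_ge0// enorm_state.
by rewrite -!addrA addrCA lerDl !addr_ge0 ?sqr_ge0.
Qed.

Lemma enorm_st_b : enorm (st_b x) <= enorm x.
Proof.
apply: bound; rewrite ?enorm_ge0// enorm_state.
by rewrite -!addrA addrA addrCA lerDl !addr_ge0 ?sqr_ge0.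
Qed.

Lemma enorm_st_Pg : enorm (st_Pg x) <= enorm x.
Proof.
apply: bound; rewrite ?enorm_ge0// enorm_state.
by rewrite -addrA addrCA lerDl !addr_ge0 ?sqr_ge0.
Qed.

Lemma norm_st_lambda : `|st_lambda x| <= enorm x.
Proof.
apply: bound; rewrite ?normr_ge0// enorm_state real_normK ?num_real//.
by rewrite lerDr !addr_ge0 ?sqr_ge0.
Qed.

End StateNorms.

Section PotentialBounds.
Variables (R : realType) (n m : nat) (N : bidding_network R n m).
Hypothesis hS : standing_assumptions N.
Variables (phibar : 'cV[R]_(n.-1)) (gamma : R).
Hypothesis gamma_lt : gamma < pi / 2.
Hypothesis gamma_ge0 : 0 <= gamma.
Let region (phi : 'cV[R]_(n.-1)) :=
  forall k, - gamma <= line_angles N phi k 0 <= gamma.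
Hypothesis phibar_region : region phibar.
Let U := potential N.
Let grad := gradient U.

Let cosg_gt0 : 0 < cos gamma.
Proof.
apply: cos_gt0_pihalf; rewrite gamma_lt andbT.
by rewrite (lt_le_trans _ gamma_ge0)// oppr_lt0 divr_gt0 ?pi_gt0.
Qed.

Lemma dot_gradient_potentialB phi v :
  dot (grad phi - grad phibar) v =
  \sum_k Gamma N k k * (line_angles N v k 0 *
    (sin (line_angles N phi k 0) - sin (line_angles N phibar k 0))).
Proof.
rewrite dotDl dotNl !dot_gradient_potential -sumrB.
by apply: eq_bigr => k _; rewrite -mulrBr -mulrBr.
Qed.

(** Scalar estimates on each line add up to this weighted sum, which in turn is comparable to the
    squared distance of [phi] from [phibar]. *)
Let energy (phi : 'cV[R]_(n.-1)) :=
  \sum_k Gamma N k k *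
    (line_angles N phi k 0 - line_angles N phibar k 0) ^+ 2.

Let energyE phi : energy phi =
  dot (line_angles N (phi - phibar)) (Gamma N *m line_angles N (phi - phibar)).
Proof.
rewrite dotE; apply: eq_bigr => k _.
have -> : (Gamma N *m line_angles N (phi - phibar)) k 0 =
    Gamma N k k * line_angles N (phi - phibar) k 0.
  rewrite {1}/Gamma mul_diag_mx mxE; congr (_ * _).
  by rewrite [RHS]mxE eqxx mulr1n.
by rewrite coord_line_anglesB expr2 mulrCA.
Qed.

Let energy_lower : exists2 c, 0 < c &
  forall phi, c * enorm (phi - phibar) ^+ 2 <= energy phi.
Proof.
have Gpos : positive_diagonal (Gamma N).
  by split; [exact: diag_mx_is_diag|exact: Gamma_gt0].
have [c1 c10 c1P] := positive_diagonal_coercive Gpos.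
have [c2 c20 c2P] := line_angles_coercive hS.
exists (c1 * c2) => [|phi]; first exact: mulr_gt0.
rewrite energyE enorm_sqr -mulrA (le_trans _ (c1P _))//.
by rewrite ler_wpM2l ?(ltW c10)// c2P.
Qed.

Let line_angles_bound : exists2 C, 0 <= C &
  forall phi, enorm (line_angles N phi) <= C * enorm phi.
Proof.
have [C C0 CP] := enorm_mulmx ((Dinc N)^T *m (Dtree_pinv N)^T).
by exists C => // phi; rewrite /line_angles mulmxA.
Qed.

Lemma gradient_potential_monotone : exists2 c, 0 < c &
  forall phi, region phi ->
    c * enorm (phi - phibar) ^+ 2 <= dot (grad phi - grad phibar) (phi - phibar).
Proof.
have [c c0 cP] := energy_lower.
exists (cos gamma * c) => [|phi reg]; first exact: mulr_gt0.
rewrite -mulrA (@le_trans _ _ (cos gamma * energy phi))//.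
  by rewrite ler_wpM2l ?(ltW cosg_gt0).
rewrite dot_gradient_potentialB mulr_sumr; apply: ler_sum => k _.
rewrite mulrCA ler_wpM2l ?(ltW (Gamma_gt0 hS k))//.
rewrite coord_line_anglesB.
exact: sin_strongly_monotone.
Qed.

(** Sine is 1-Lipschitz. This supplies the potential part of the bound on the gradient of [Weps]. *)
Lemma gradient_potential_lipschitz : exists2 K, 0 <= K &
  forall phi v, `|dot (grad phi - grad phibar) v|
    <= K * (enorm (phi - phibar) * enorm v).
Proof.
have [C C0 CP] := line_angles_bound.
have G0 : 0 <= \sum_k Gamma N k k.
  by apply: sumr_ge0 => k _; rewrite ltW// Gamma_gt0.
exists ((\sum_k Gamma N k k) * (C * C)) => [|phi v].
  by rewrite !mulr_ge0.
rewrite dot_gradient_potentialB (le_trans (ler_norm_sum _ _ _))//.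
rewrite -mulrA mulr_suml; apply: ler_sum => k _.
rewrite normrM (gtr0_norm (Gamma_gt0 hS k)) ler_wpM2l ?(ltW (Gamma_gt0 hS k))//.
rewrite mulrACA normrM mulrC ler_pM//.
  rewrite (le_trans (sin_lipschitz _ _))// (le_trans _ (CP _))//.
  by rewrite (le_trans _ (coord_le_enorm _ k))// coord_line_anglesB.
by rewrite (le_trans _ (CP _))// coord_le_enorm.
Qed.

Let bregman phi := U phi - dot (phi - phibar) (grad phibar) - U phibar.

Let bregmanE phi : bregman phi = \sum_k Gamma N k k *
  (cos (line_angles N phibar k 0) - cos (line_angles N phi k 0)
   - (line_angles N phi k 0 - line_angles N phibar k 0)
     * sin (line_angles N phibar k 0)).
Proof.
rewrite /bregman /U dotC dot_gradient_potential !potentialE opprK.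
rewrite -!sumrN -!big_split /=; apply: eq_bigr => k _.
rewrite coord_line_anglesB.
move: (Gamma N k k) (line_angles N phi k 0) (line_angles N phibar k 0).
move=> c u v; ring.
Qed.

Lemma potential_bregman_lower : exists2 c, 0 < c &
  forall phi, region phi -> c * enorm (phi - phibar) ^+ 2 <= bregman phi.
Proof.
have [c c0 cP] := energy_lower.
have cg0 : 0 < cos gamma / 2 by rewrite divr_gt0.
exists (cos gamma / 2 * c) => [|phi reg]; first exact: mulr_gt0.
rewrite -(mulrA (_ / 2)) (@le_trans _ _ (cos gamma / 2 * energy phi))//.
  by rewrite ler_wpM2l ?(ltW cg0).
rewrite bregmanE mulr_sumr; apply: ler_sum => k _.
rewrite mulrCA ler_wpM2l ?(ltW (Gamma_gt0 hS k))//.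
exact: cos_bregman_lower.
Qed.

Lemma potential_bregman_upper : exists2 K, 0 <= K &
  forall phi, bregman phi <= K * enorm (phi - phibar) ^+ 2.
Proof.
have [C1 C10 C1P] := line_angles_bound.
have [C2 C20 C2P] := dot_mulmx_bound (Gamma N).
exists (C2 * (C1 * C1)) => [|phi]; first by rewrite !mulr_ge0.
apply: (@le_trans _ _ (energy phi)).
  rewrite bregmanE; apply: ler_sum => k _.
  rewrite ler_wpM2l ?(ltW (Gamma_gt0 hS k))//.
  exact: cos_bregman_upper.
rewrite energyE (le_trans (ler_norm _))// (le_trans (C2P _ _))//.
rewrite -mulrA ler_wpM2l// expr2 mulrACA.
by rewrite ler_pM ?enorm_ge0.
Qed.

End PotentialBounds.

(** * Dissipation *)

Section LyapunovEstimate.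
Variables (R : realType) (n m : nat) (N : bidding_network R n m).
Hypothesis hS : standing_assumptions N.
Variable xbar : 'cV[R]_(state_dim n).
Hypothesis hxbar : closed_loop N xbar = 0.
Variable gamma : R.
Hypothesis gamma_lt : gamma < pi / 2.
Hypothesis gamma_ge0 : 0 <= gamma.
Hypothesis xbar_region : angle_region N gamma xbar.

Let M := inertia N.
Let A := damping N.
Let D := Dtree N.
Let P := Dtree_pinv N.
Let Qi := invmx (Qmx N).
Let Tbi := invmx (Tb N).
Let one := ones R n.
Let grad := gradient (potential N).
Let s := (sigma N ^+ 2)^-1.

Let Qi_sym : Qi^T = Qi.
Proof.
apply: positive_diagonal_trmx.
by case: (positive_diagonal_inv (Qmx_positive_diagonal hS)).
Qed.

Let Tbi_sym : Tbi^T = Tbi.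
Proof.
apply: positive_diagonal_trmx.
by case: (positive_diagonal_inv (Tb_positive_diagonal hS)).
Qed.

Let s_gt0 : 0 < s. Proof. by rewrite invr_gt0 exprn_gt0// (sigma_gt0 hS). Qed.

(** The couplings inside [V] are skew and cancel, which leaves the three dissipation terms. In the
    cross terms [P *m D = 1] isolates [- dot g a], and the rates of [b] and [Pg] yield the negative
    squares of [p] and [l]. *)
Lemma dWeps_closed_loop e0 e1 e2 e3 x :
  let a := st_phi (x - xbar) in let w := st_omega (x - xbar) in
  let b := st_b (x - xbar) in let p := st_Pg (x - xbar) in
  let l := st_lambda (x - xbar) in
  let g := grad (st_phi x) - grad (st_phi xbar) in
  dWeps N xbar e0 e1 e2 e3 x (closed_loop N x) =
  - dot w (A *m w) - s * dot b (Qi *m b) - s * rho N * dot one p ^+ 2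
  + e0 * (e1 * (- dot g a + dot w ((D *m P *m M) *m w)
                - dot a ((P *m A) *m w) + dot a (P *m p))
    + e2 * (- (s * dot p ((Tbi *m Tg N) *m p))
            + s * dot b ((Qi *m Tbi *m Tg N) *m p)
            + s * rho N * (dot one p * dot one b)
            - s * (l * dot one b) + s * dot b b + dot b w)
    + e3 * (- (s * dot one one * l ^+ 2)
            + s / tau N * (dot one p * dot one (Tg N *m p))
            + s * (l * dot one b) + s * rho N * dot one one * (l * dot one p)
            + l * dot one w)).
Proof.
move=> a w b p l g.
have wE : st_omega x = w by rewrite /w st_omegaB (equilibrium_omega hS hxbar) subr0.
rewrite /dWeps (deviation_omega hS hxbar) (deviation_b hS hxbar).
rewrite (deviation_Pg hS hxbar) (deviation_lambda hS hxbar).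
rewrite (closed_loop_phi N x) wE -/a -/b -/p -/l -/grad -/g -/one -/s.
have -> : st_b (closed_loop N x) = Tbi *m (p - Qi *m b).
  rewrite -(deviation_b hS hxbar) mulKmx//.
  by case: (positive_diagonal_inv (Tb_positive_diagonal hS)).
have -> : st_lambda (closed_loop N x) = - ((tau N)^-1 * dot one p).
  rewrite -mulrN -(deviation_lambda hS hxbar) mulKf// gt_eqF//.
  exact: tau_gt0 hS.
rewrite -/D -/M -/P -/A -/Qi.
clear wE; clearbody a w b p l g.
have H1 : dot g (D^T *m w) + dot w (- (D *m g) - A *m w + p) =
    - dot w (A *m w) + dot w p.
  by rewrite !dotDr !dotNr (dotC g) dot_mulmxl trmxK; ring.
(* The pairs [b], [p] and [p], [l] cancel. What remains of the frequency feedback,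
   [sigma N ^+ 2 * dot w p], cancels after division by [sigma N ^+ 2] against the [dot w p] of
   [H1]. *)
have H2 : dot b (p - Qi *m b)
    + dot p (l *: one - b - (rho N * dot one p) *: one - sigma N ^+ 2 *: w)
    + l * - dot one p =
    - dot b (Qi *m b) - rho N * dot one p ^+ 2 - sigma N ^+ 2 * dot w p.
  rewrite !dotDr !dotNr !dotZr (dotC p one) (dotC p b) (dotC p w).
  move: (dot _ _) (dot _ _) (dot _ _) (dot _ _) => d1 d2 d3 d4; ring.
have H3 : dot (D^T *m w) (P *m (M *m w))
    + dot a (P *m (- (D *m g) - A *m w + p)) =
    - dot g a + dot w ((D *m P *m M) *m w) - dot a ((P *m A) *m w)
    + dot a (P *m p).
  rewrite dot_mulmxl trmxK !mulmxDr !mulmxN (mulmxA P D) (Dtree_pinv_mul hS).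
  rewrite mul1mx !dotDr !dotNr !mulmxA (dotC a g).
  move: (dot _ _) (dot _ _) (dot _ _) (dot _ _) => d1 d2 d3 d4; ring.
have H4 : dot (Tbi *m (p - Qi *m b)) (Tg N *m p)
    + dot b (l *: one - b - (rho N * dot one p) *: one - sigma N ^+ 2 *: w) =
    dot p ((Tbi *m Tg N) *m p) - dot b ((Qi *m Tbi *m Tg N) *m p)
    + l * dot one b - dot b b - rho N * (dot one p * dot one b)
    - sigma N ^+ 2 * dot b w.
  rewrite dot_mulmxl Tbi_sym dotDl dotNl dot_mulmxl Qi_sym !mulmxA.
  rewrite !dotDr !dotNr !dotZr (dotC b one).
  move: (dot _ _) (dot _ _) (dot _ _) (dot _ _) (dot _ _) (dot _ _).
  move=> d1 d2 d3 d4 d5 d6; ring.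
have H5 : - ((tau N)^-1 * dot one p) * dot one (Tg N *m p)
    + l * dot one (l *: one - b - (rho N * dot one p) *: one
                   - sigma N ^+ 2 *: w) =
    - ((tau N)^-1 * (dot one p * dot one (Tg N *m p)))
    + dot one one * l ^+ 2 - l * dot one b
    - rho N * dot one one * (l * dot one p)
    - sigma N ^+ 2 * (l * dot one w).
  rewrite !dotDr !dotNr !dotZr.
  move: (dot _ _) (dot _ _) (dot _ _) (dot _ _) (dot _ _).
  move=> d1 d2 d3 d4 d5; ring.
rewrite H1 H2 H3 H4 H5.
clear H1 H2 H3 H4 H5.
repeat match goal with |- context [dot ?u ?v] => generalize (dot u v); intro end.
have := lt0r_neq0 (sigma_gt0 hS); have := lt0r_neq0 (tau_gt0 hS); rewrite /s.
by move: (sigma N) (tau N) (rho N) => *; field; apply/andP.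
Qed.

Let one_gt0 : 0 < enorm one.
Proof.
rewrite lt0r enorm_ge0 andbT; apply/eqP => o0.
have /dot_eq0/colP/(_ (Ordinal (edge_connected hS).1)) : dot one one = 0.
  by rewrite -enorm_sqr o0 expr0n.
by rewrite !mxE => /eqP; rewrite oner_eq0.
Qed.

(** The cap [e1] leaves room for the other smallness condition on [eps0], the positivity of
    [Weps]. *)
Lemma Weps_dissipation e1 : 0 < e1 ->
  exists delta e alpha, [/\ 0 < delta <= 1, 0 < e <= e1, 0 < alpha &
    forall x, angle_region N gamma x ->
      dWeps N xbar e delta 1 delta x (closed_loop N x)
      <= - alpha * enorm (x - xbar) ^+ 2].
Proof.
move=> e10.
have [c1 c10 c1P] := positive_diagonal_coercive (damping_pos hS).
have [_ Qi_pos] := positive_diagonal_inv (Qmx_positive_diagonal hS).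
have [_ Tbi_pos] := positive_diagonal_inv (Tb_positive_diagonal hS).
have [c2 c20 c2P] := positive_diagonal_coercive Qi_pos.
have [c3 c30 c3P] :=
  gradient_potential_monotone hS gamma_lt gamma_ge0 xbar_region.
have [c4 c40 c4P] := positive_diagonal_coercive
  (positive_diagonal_mul Tbi_pos (Tg_positive_diagonal hS)).
have [K1 K10 K1P] := dot_mulmx_bound (D *m P *m M).
have [K2 K20 K2P] := dot_mulmx_bound (P *m A).
have [K3 K30 K3P] := dot_mulmx_bound P.
have [K4 K40 K4P] := dot_mulmx_bound (Qi *m Tbi *m Tg N).
have [K5 K50 K5P] := dot_mulmx_bound (Tg N).
pose k := enorm one.
have k_gt0 : 0 < k by exact: one_gt0.
have k0 := ltW k_gt0.
have s0 := ltW s_gt0.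
have rho0 := ltW (rho_gt0 hS).
have tau0 : 0 <= (tau N)^-1 by rewrite invr_ge0 ltW// (tau_gt0 hS).
have st0 : 0 <= s / tau N by exact: mulr_ge0.
(* The weakest of five decay rates: damping for [w], the inverse costs for [b], convexity of [U] for
   [a], [Tbi *m Tg N] for [p], and [dot one one = k ^+ 2] for [l]. *)
pose c := Num.min c1 (Num.min (s * c2) (Num.min c3
  (Num.min (s * c4) (s * k ^+ 2)))).
have c0 : 0 < c by rewrite !lt_min c10 c30 !mulr_gt0// exprn_gt0.
have [cc1 cc2 cc3 cc4 cc5] :
    [/\ c <= c1, c <= s * c2, c <= c3, c <= s * c4 & c <= s * k ^+ 2].
  by split; rewrite !ge_min lexx ?orbT.
clearbody c.
(* [K] adds up the bounds on all indefinite terms; the leading 1 is the coefficient of [dot b w] and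
   makes [K] positive. *)
pose K := 1 + K1 + K2 + K3 + (s * K4 + s * rho N * (k * k)) + s * k + s + k
  + s / tau N * (k * (K5 * k)) + s * rho N * k ^+ 2 * k.
have [P1 P2 P3 P4 P5] : [/\ 0 <= s * K4, 0 <= s * rho N * (k * k),
    0 <= s * k, 0 <= s / tau N * (k * (K5 * k)) &
    0 <= s * rho N * k ^+ 2 * k].
  by split; rewrite !mulr_ge0.
have [KK1 KK2 KK3 KK4 KK5] : [/\ K1 <= K, K2 <= K, K3 <= K,
  s * K4 + s * rho N * (k * k) <= K & s * k <= K].
  clear - hS hxbar gamma_lt gamma_ge0
    xbar_region M A D P Qi Tbi one grad s Qi_sym Tbi_sym s_gt0 one_gt0 K10 K20 K30 s0 k0 P1 P2 P3 P4 P5.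
  by split; rewrite /K; lra.
have [KK6 KK7 KK8 KK9 KK10] : [/\ s <= K, 1 <= K, k <= K,
  s / tau N * (k * (K5 * k)) <= K & s * rho N * k ^+ 2 * k <= K].
  clear - hS hxbar gamma_lt gamma_ge0
    xbar_region M A D P Qi Tbi one grad s Qi_sym Tbi_sym s_gt0 one_gt0 K10 K20 K30 s0 k0 P1 P2 P3 P4 P5.
  by split; rewrite /K; lra.
clearbody K.
have K0 : 0 < K by exact: lt_le_trans KK7.
have [delta [e [alpha [delta01 e01 alpha0 diss]]]] :=
  hierarchical_dissipation c0 K0 e10.
exists delta, e, alpha; split=> // x xreg.
have := dWeps_closed_loop e delta 1 delta x; cbv zeta => ->.
rewrite enorm_state.
have := c3P _ xreg; rewrite -st_phiB -/grad.
set g := grad (st_phi x) - grad (st_phi xbar).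
move: (st_phi (x - xbar)) (st_omega (x - xbar)) (st_b (x - xbar))
  (st_Pg (x - xbar)) (st_lambda (x - xbar)) => a w b p l ga.
(* Both signs are kept because [l * dot one b] enters negatively in the second cross term and
   positively in the third. *)
have le_K X C Y : `|X| <= C * Y -> 0 <= Y -> C <= K -> X <= K * Y /\ - X <= K * Y.
  move=> XC Y0 CK; have : `|X| <= K * Y by rewrite (le_trans XC)// ler_wpM2r.
  by rewrite ler_norml => /andP[? ?]; split=> //; rewrite lerNl.
have na := enorm_ge0 a; have nw := enorm_ge0 w; have nb := enorm_ge0 b.
have np := enorm_ge0 p; have nl := normr_ge0 l.
have oneb := dot_cauchy_schwarz one b; have onep := dot_cauchy_schwarz one p.
have onew := dot_cauchy_schwarz one w; rewrite -/k in oneb onep onew.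
have oneTp : `|dot one (Tg N *m p)| <= K5 * k * enorm p.
  by rewrite -mulrA; exact: K5P.
have [w2 _] := le_K _ _ _ (K1P w w) (mulr_ge0 nw nw) KK1.
have [_ aw] := le_K _ _ _ (K2P a w) (mulr_ge0 na nw) KK2.
have [ap _] := le_K _ _ _ (K3P a p) (mulr_ge0 na np) KK3.
have bp : s * dot b ((Qi *m Tbi *m Tg N) *m p)
    + s * rho N * (dot one p * dot one b) <= K * (enorm b * enorm p).
  rewrite (le_trans _ (ler_wpM2r (mulr_ge0 nb np) KK4))// mulrDl.
  rewrite -!mulrA; apply: lerD; rewrite ler_wpM2l//.
    exact: (le_trans (ler_norm _) (K4P b p)).
  rewrite ler_wpM2l// (le_trans (ler_norm _))// normrM.
  rewrite (_ : k * _ = (k * enorm p) * (k * enorm b)); last by ring.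
  by rewrite ler_pM.
have lb : `|s * (l * dot one b)| <= s * k * (`|l| * enorm b).
  by rewrite !normrM (ger0_norm s0) mulrACA -!mulrA !ler_wpM2l.
have [lb1 lb2] := le_K _ _ _ lb (mulr_ge0 nl nb) KK5.
have bb : s * dot b b <= K * enorm b ^+ 2.
  by rewrite enorm_sqr ler_wpM2r// dot_ge0.
have bw : `|dot b w| <= 1 * (enorm b * enorm w).
  by rewrite mul1r dot_cauchy_schwarz.
have [{}bw _] := le_K _ _ _ bw (mulr_ge0 nb nw) KK7.
have p2 : `|s / tau N * (dot one p * dot one (Tg N *m p))|
    <= s / tau N * (k * (K5 * k)) * (enorm p * enorm p).
  rewrite normrM (ger0_norm st0) -mulrA ler_wpM2l// normrM.
  by rewrite mulrACA ler_pM.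
have [{}p2 _] := le_K _ _ _ p2 (mulr_ge0 np np) KK9.
have lp : `|s * rho N * dot one one * (l * dot one p)|
    <= s * rho N * k ^+ 2 * k * (`|l| * enorm p).
  rewrite -enorm_sqr normrM ger0_norm ?mulr_ge0 ?exprn_ge0// -(mulrA _ k).
  by rewrite ler_wpM2l ?mulr_ge0 ?exprn_ge0// normrM mulrCA ler_wpM2l.
have [{}lp _] := le_K _ _ _ lp (mulr_ge0 nl np) KK10.
have lw : `|l * dot one w| <= k * (`|l| * enorm w).
  by rewrite normrM mulrCA ler_wpM2l.
have [{}lw _] := le_K _ _ _ lw (mulr_ge0 nl nw) KK8.
have wA : c * enorm w ^+ 2 <= dot w (A *m w).
  by rewrite enorm_sqr (le_trans _ (c1P w))// ler_wpM2r ?dot_ge0.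
have bQ : c * enorm b ^+ 2 <= s * dot b (Qi *m b).
  rewrite enorm_sqr (@le_trans _ _ (s * c2 * dot b b))//.
    by rewrite ler_wpM2r ?dot_ge0.
  by rewrite -mulrA ler_wpM2l.
have {}ga : c * enorm a ^+ 2 <= dot g a.
  by rewrite (le_trans _ ga)// ler_wpM2r ?exprn_ge0.
have pT : c * enorm p ^+ 2 <= s * dot p ((Tbi *m Tg N) *m p).
  rewrite enorm_sqr (@le_trans _ _ (s * c4 * dot p p))//.
    by rewrite ler_wpM2r ?dot_ge0.
  by rewrite -mulrA ler_wpM2l.
(* The scalar inequality is applied to norms, so [l] is replaced by its absolute value. *)
have l2E : l ^+ 2 = `|l| ^+ 2 by rewrite real_normK ?num_real.
have l2 : c * `|l| ^+ 2 <= s * dot one one * `|l| ^+ 2.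
  by rewrite -enorm_sqr ler_wpM2r ?sqr_ge0.
rewrite l2E.
have rho2 : 0 <= s * rho N * dot one p ^+ 2.
  exact: (mulr_ge0 (mulr_ge0 s0 rho0) (sqr_ge0 _)).
have := diss (enorm a) (enorm w) (enorm b) (enorm p) `|l|.
apply: le_trans.
case/andP: delta01 => delta0 _; case/andP: e01 => e0 _.
rewrite mul1r; apply: lerD.
  clear - hS hxbar gamma_lt gamma_ge0
    xbar_region M A D P Qi Tbi one grad s Qi_sym Tbi_sym s_gt0 one_gt0 wA bQ rho2.
  move: wA bQ rho2.
  repeat match goal with |- context [dot ?u ?v] => generalize (dot u v); intro end.
  move=> *; lra.
rewrite ler_wpM2l ?(ltW e0)//; apply: lerD; first apply: lerD.
- rewrite ler_wpM2l ?(ltW delta0)//.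
  clear - hS hxbar gamma_lt gamma_ge0
    xbar_region M A D P Qi Tbi one grad s Qi_sym Tbi_sym s_gt0 one_gt0 ga w2 aw ap.
  move: ga w2 aw ap.
  repeat match goal with |- context [dot ?u ?v] => generalize (dot u v); intro end.
  rewrite !expr2; move=> *; lra.
- clear - hS hxbar gamma_lt gamma_ge0
    xbar_region M A D P Qi Tbi one grad s Qi_sym Tbi_sym s_gt0 one_gt0 pT bp lb2 bb bw.
  move: pT bp lb2 bb bw.
  repeat match goal with |- context [dot ?u ?v] => generalize (dot u v); intro end.
  rewrite (mulrC (enorm b) `|l|) !expr2; move=> *; lra.
rewrite ler_wpM2l ?(ltW delta0)//.
clear - hS hxbar gamma_lt gamma_ge0
    xbar_region M A D P Qi Tbi one grad s Qi_sym Tbi_sym s_gt0 one_gt0 l2 p2 lb1 lp lw.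
move: l2 p2 lb1 lp lw.
repeat match goal with |- context [dot ?u ?v] => generalize (dot u v); intro end.
rewrite !expr2; move=> *; lra.
Qed.

End LyapunovEstimate.

(** * Bounds on the Lyapunov function *)

Section LyapunovBounds.
Variables (R : realType) (n m : nat) (N : bidding_network R n m).
Hypothesis hS : standing_assumptions N.
Variable xbar : 'cV[R]_(state_dim n).
Hypothesis hxbar : closed_loop N xbar = 0.
Variable gamma : R.
Hypothesis gamma_lt : gamma < pi / 2.
Hypothesis gamma_ge0 : 0 <= gamma.
Hypothesis xbar_region : angle_region N gamma xbar.

Let s := (sigma N ^+ 2)^-1.

Let s_gt0 : 0 < s. Proof. by rewrite invr_gt0 exprn_gt0// (sigma_gt0 hS). Qed.

Let omegaE x : st_omega x = st_omega (x - xbar).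
Proof. by rewrite st_omegaB (equilibrium_omega hS hxbar) subr0. Qed.

Let halfs : (2 * sigma N ^+ 2)^-1 = s / 2.
Proof. by rewrite invfM mulrC. Qed.

(** [V] alone dominates [c] times the squared distance, and the cross terms cost at most [e * K]
    times it. That [c] and [K] precede [delta] and [e] is what allows [e] to be capped in
    advance. *)
Lemma Weps_lower : exists c K, [/\ 0 < c, 0 <= K &
  forall delta e x, 0 <= delta <= 1 -> 0 <= e -> angle_region N gamma x ->
    (c - e * K) * enorm (x - xbar) ^+ 2 <= Weps N xbar e delta 1 delta x].
Proof.
have [c1 c10 c1P] := potential_bregman_lower hS gamma_lt gamma_ge0 xbar_region.
have [c2 c20 c2P] := positive_diagonal_coercive (inertia_pos hS).
have [c3 c30 c3P] := positive_diagonal_coercive (Tb_positive_diagonal hS).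
have [c4 c40 c4P] := positive_diagonal_coercive (Tg_positive_diagonal hS).
have tau0 := tau_gt0 hS.
have s2_gt0 : 0 < s / 2 by rewrite divr_gt0.
pose c := Num.min c1 (Num.min (2^-1 * c2) (Num.min (s / 2 * c3)
  (Num.min (s / 2 * c4) (s / 2 * tau N)))).
have c0 : 0 < c.
  by rewrite !lt_min c10 !(mulr_gt0 s2_gt0)// mulr_gt0.
have [cc1 cc2 cc3 cc4 cc5] : [/\ c <= c1, c <= 2^-1 * c2, c <= s / 2 * c3,
    c <= s / 2 * c4 & c <= s / 2 * tau N].
  by split; rewrite !ge_min lexx ?orbT.
clearbody c.
have [K1 K10 K1P] := dominated_dot setT (Dtree_pinv N *m inertia N)
  (fun x => enorm_st_phi (x - xbar)) (fun x => enorm_st_omega (x - xbar)).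
have [K2 K20 K2P] := dominated_dot setT (Tg N)
  (fun x => enorm_st_b (x - xbar)) (fun x => enorm_st_Pg (x - xbar)).
have lam : dominated setT (fun x => enorm (x - xbar))
    (fun x => st_lambda (x - xbar)).
  by exists 1 => // x _; rewrite mul1r norm_st_lambda.
have [K3 K30 K3P] := dominated_mul lam (dominated_dot_cst setT (ones R n) (Tg N)
  (fun x => enorm_st_Pg (x - xbar))).
exists c, (K1 + s * K2 + s * K3); split=> //.
  by rewrite !addr_ge0 ?mulr_ge0 ?(ltW s_gt0).
move=> delta e x /andP[d0 d1] e0 xreg.
have K1x : `|dot (st_phi (x - xbar)) (Dtree_pinv N *m (inertia N
    *m st_omega (x - xbar)))| <= K1 * enorm (x - xbar) ^+ 2.
  by rewrite mulmxA expr2; exact: K1P.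
have K2x : `|dot (st_b (x - xbar)) (Tg N *m st_Pg (x - xbar))|
    <= K2 * enorm (x - xbar) ^+ 2 by rewrite expr2; exact: K2P.
have K3x : `|st_lambda (x - xbar) * dot (ones R n) (Tg N *m st_Pg (x - xbar))|
    <= K3 * enorm (x - xbar) ^+ 2 by rewrite expr2; exact: K3P.
move: K1x K2x K3x; rewrite /Weps /Vfun /wsqnorm -!st_phiB -!st_bB -!st_PgB.
rewrite -!st_lambdaB halfs (omegaE x) -/s !mulr1.
have := c1P _ xreg; rewrite -st_phiB.
have := c2P (st_omega (x - xbar)); have := c3P (st_b (x - xbar)).
have := c4P (st_Pg (x - xbar)); rewrite -!enorm_sqr enorm_state.
have := sqr_ge0 (enorm (st_phi (x - xbar))).
have := sqr_ge0 (enorm (st_omega (x - xbar))).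
have := sqr_ge0 (enorm (st_b (x - xbar))).
have := sqr_ge0 (enorm (st_Pg (x - xbar))).
have := sqr_ge0 (st_lambda (x - xbar)).
move: (_ * dot (ones R n) _) (potential N _ - _ - _).
move: (dot _ (Dtree_pinv N *m _)) (dot (st_b _) (Tg N *m _)).
move: (dot _ (inertia N *m _)) (dot _ (Tb N *m _)) (dot _ (Tg N *m _)).
move: (enorm (st_phi _) ^+ 2) (enorm (st_omega _) ^+ 2) (enorm (st_b _) ^+ 2).
move: (enorm (st_Pg _) ^+ 2) (st_lambda _ ^+ 2) => p2 l2 a2 w2 b2.
move=> wMw bTb pTp aw bp lp B l0 p0 b0 w0 a0 pp bb ww aB.
set X := a2 + w2 + b2 + p2 + l2 => aX bX lX.
(* Here [delta <= 1] is spent, which frees the constants of [delta]. *)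
have cross y Y : `|y| <= Y -> - (e * Y) <= e * delta * y <= e * Y.
  move=> yY; rewrite -ler_norml -mulrA normrM (ger0_norm e0) ler_wpM2l//.
  by rewrite normrM (ger0_norm d0) (le_trans _ yY)// ler_piMl.
have s_ge0 := ltW s_gt0.
have /andP[aX1 _] := cross _ _ aX.
have /andP[_ lX2] := cross _ _ lX.
have {lX2} : s * (e * delta * lp) <= s * (e * (K3 * X)) by rewrite ler_wpM2l.
have bX2 : s * (e * bp) <= s * (e * (K2 * X)).
  by rewrite !ler_wpM2l// (le_trans (ler_norm _)).
have wc : c * w2 <= 2^-1 * wMw.
  by rewrite (le_trans (ler_wpM2r w0 cc2))// -mulrA ler_wpM2l ?invr_ge0.
have bc : c * b2 <= s / 2 * bTb.
  by rewrite (le_trans (ler_wpM2r b0 cc3))// -(mulrA (s / 2)) ler_wpM2l// ltW.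
have pc : c * p2 <= s / 2 * pTp.
  by rewrite (le_trans (ler_wpM2r p0 cc4))// -(mulrA (s / 2)) ler_wpM2l// ltW.
have lc : c * l2 <= s / 2 * (tau N * l2).
  by rewrite (le_trans (ler_wpM2r l0 cc5))// -(mulrA (s / 2)).
have ac : c * a2 <= B by rewrite (le_trans _ aB)// ler_wpM2r.
 have : c * X = c * a2 + c * w2 + c * b2 + c * p2 + c * l2 by rewrite /X; ring.
by clearbody X => cX lX2; lra.
Qed.

(** The constant may depend on [delta] and [e], which are already fixed when it is needed. *)
Lemma Weps_upper delta e : exists2 C, 0 <= C &
  forall x, Weps N xbar e delta 1 delta x <= C * enorm (x - xbar) ^+ 2.
Proof.
have [C1 C10 C1P] := potential_bregman_upper hS (st_phi xbar).
pose rest x := 2^-1 * dot (st_omega (x - xbar)) (inertia N *m st_omega (x - xbar))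
  + (2 * sigma N ^+ 2)^-1 *
      (dot (st_b (x - xbar)) (Tb N *m st_b (x - xbar))
       + dot (st_Pg (x - xbar)) (Tg N *m st_Pg (x - xbar))
       + tau N * (st_lambda (x - xbar) * st_lambda (x - xbar)))
  + e * delta *
      dot (st_phi (x - xbar)) ((Dtree_pinv N *m inertia N) *m st_omega (x - xbar))
  - e * 1 / sigma N ^+ 2 *
      dot (st_b (x - xbar)) (Tg N *m st_Pg (x - xbar))
  - e * delta / sigma N ^+ 2 *
      (st_lambda (x - xbar) * dot (ones R n) (Tg N *m st_Pg (x - xbar))).
have lam : dominated setT (fun x => enorm (x - xbar))
    (fun x => st_lambda (x - xbar)).
  by exists 1 => // x _; rewrite mul1r norm_st_lambda.
have phiB x := enorm_st_phi (x - xbar); have omegaB x := enorm_st_omega (x - xbar).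
have bB x := enorm_st_b (x - xbar); have PgB x := enorm_st_Pg (x - xbar).
have [C2 C20 C2P] : dominated setT (fun x => enorm (x - xbar) * enorm (x - xbar)) rest.
  apply: dominatedB; [apply: dominatedB; [apply: dominatedD; [apply: dominatedD|]|]|];
    apply: dominatedZ.
  - exact: dominated_dot.
  - apply: dominatedD; [apply: dominatedD|apply: dominatedZ].
    + exact: dominated_dot.
    + exact: dominated_dot.
    + exact: dominated_mul.
  - exact: dominated_dot.
  - exact: dominated_dot.
  - by apply: dominated_mul => //; exact: dominated_dot_cst.
exists (C1 + C2) => [|x]; first exact: addr_ge0.
have -> : Weps N xbar e delta 1 delta x = potential N (st_phi x)
    - dot (st_phi (x - xbar)) (gradient (potential N) (st_phi xbar))
    - potential N (st_phi xbar) + rest x.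
  rewrite /Weps /Vfun /wsqnorm /rest -!st_phiB -!st_bB -!st_PgB -!st_lambdaB.
  by rewrite expr2 -mulmxA (omegaE x) !addrA.
rewrite mulrDl lerD//.
  rewrite st_phiB (le_trans (C1P _))// ler_wpM2l// -st_phiB.
  by rewrite ler_sqr ?nnegrE ?enorm_ge0.
by rewrite (le_trans (ler_norm _))// (le_trans (C2P _ I))// expr2.
Qed.

(** This is the linear growth of the gradient that makes a disturbance of size
    [chi * enorm (x - xbar)] harmless. Pairs of a state and a direction form the index type, so the
    calculus of [dominated] applies. *)
Lemma dWeps_bound delta e : exists2 C, 0 <= C & forall x v,
  `|dWeps N xbar e delta 1 delta x v| <= C * (enorm (x - xbar) * enorm v).
Proof.
pose T := ('cV[R]_(state_dim n) * 'cV[R]_(state_dim n))%type.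
pose N1 (t : T) := enorm (t.1 - xbar); pose N2 (t : T) := enorm t.2.
have swap (f : T -> R) : dominated setT (fun t => N2 t * N1 t) f ->
    dominated setT (fun t => N1 t * N2 t) f.
  by move=> [C C0 CP]; exists C => // t _; rewrite [N1 t * _]mulrC CP.
have phi1 (t : T) : enorm (st_phi (t.1 - xbar)) <= N1 t := enorm_st_phi _.
have phi2 (t : T) : enorm (st_phi t.2) <= N2 t := enorm_st_phi _.
have om1 (t : T) : enorm (st_omega (t.1 - xbar)) <= N1 t := enorm_st_omega _.
have om2 (t : T) : enorm (st_omega t.2) <= N2 t := enorm_st_omega _.
have b1 (t : T) : enorm (st_b (t.1 - xbar)) <= N1 t := enorm_st_b _.
have b2 (t : T) : enorm (st_b t.2) <= N2 t := enorm_st_b _.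
have p1 (t : T) : enorm (st_Pg (t.1 - xbar)) <= N1 t := enorm_st_Pg _.
have p2 (t : T) : enorm (st_Pg t.2) <= N2 t := enorm_st_Pg _.
have l1 : dominated setT N1 (fun t : T => st_lambda (t.1 - xbar)).
  by exists 1 => // t _; rewrite mul1r norm_st_lambda.
have l2 : dominated setT N2 (fun t : T => st_lambda t.2).
  by exists 1 => // t _; rewrite mul1r norm_st_lambda.
have [K K0 KP] := gradient_potential_lipschitz hS (st_phi xbar).
have [C C0 CP] : dominated setT (fun t => N1 t * N2 t)
    (fun t : T => dWeps N xbar e delta 1 delta t.1 t.2).
  apply: dominatedB; [apply: dominatedB; [apply: dominatedD;
    [apply: dominatedD; [apply: dominatedD|]|]|]|].
  - exists K => // t _; rewrite (le_trans (KP _ _))// -st_phiB ler_wpM2l//.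
    by rewrite ler_pM ?enorm_ge0.
  - have -> : (fun t : T => dot (st_omega t.1) (inertia N *m st_omega t.2)) =
        (fun t => dot (st_omega (t.1 - xbar)) (inertia N *m st_omega t.2)).
      by apply/funext => t; rewrite (omegaE t.1).
    exact: dominated_dot.
  - apply: dominatedZ; apply: dominatedD; [apply: dominatedD|].
    + exact: dominated_dot.
    + exact: dominated_dot.
    + by apply: dominated_mul => //; exact: dominatedZ.
  - apply: dominatedZ; apply: dominatedD.
    + have -> : (fun t : T => dot (st_phi t.2)
            (Dtree_pinv N *m (inertia N *m st_omega t.1))) =
          (fun t => dot (st_phi t.2)
            ((Dtree_pinv N *m inertia N) *m st_omega (t.1 - xbar))).
        by apply/funext => t; rewrite (omegaE t.1) mulmxA.
      by apply: swap => //; exact: dominated_dot.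
    + have -> : (fun t : T => dot (st_phi (t.1 - xbar))
            (Dtree_pinv N *m (inertia N *m st_omega t.2))) =
          (fun t => dot (st_phi (t.1 - xbar))
            ((Dtree_pinv N *m inertia N) *m st_omega t.2)).
        by apply/funext => t; rewrite mulmxA.
      exact: dominated_dot.
  - apply: dominatedZ; apply: dominatedD.
    + by apply: swap => //; exact: dominated_dot.
    + exact: dominated_dot.
  - apply: dominatedZ; apply: dominatedD.
    + apply: swap => //; apply: dominated_mul => //; exact: dominated_dot_cst.
    + by apply: dominated_mul => //; exact: dominated_dot_cst.
by exists C => // x v; exact: (CP (x, v)).
Qed.

End LyapunovBounds.

(* [`|line_angles N (st_phi xbar)|] is the sup norm. *)
Theorem mainTheorem1 (R : realType) (n m q : nat) (N : bidding_network R n m)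
    (hS : standing_assumptions N)
    (xbar : 'cV[R]_(state_dim n)) (hxbar : closed_loop N xbar = 0)
    (hetabar : forall k, - (pi / 2) < line_angles N (st_phi xbar) k 0 < pi / 2)
    (B : 'M[R]_(state_dim n, q))
    (gamma : R) (hgamma : `|line_angles N (st_phi xbar)| < gamma < pi / 2) :
  exists eps0 eps1 eps2 eps3 : R,
    [/\ 0 < eps0, 0 < eps1, 0 < eps2 & 0 < eps3] /\
    LISS_Lyapunov (closed_loop N) B (angle_region N gamma) xbar
      (Weps N xbar eps0 eps1 eps2 eps3) /\
    exists alpha chi c1 c2 : R,
      [/\ 0 < alpha, 0 < chi, 0 < c1 & 0 < c2] /\
      forall (x : 'cV[R]_(state_dim n)) (d : 'cV[R]_q),
        angle_region N gamma x -> enorm d <= chi * enorm (x - xbar) ->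
        2^-1 * c1 * enorm (x - xbar) ^+ 2 <= Weps N xbar eps0 eps1 eps2 eps3 x
          <= 2^-1 * c2 * enorm (x - xbar) ^+ 2 /\
        dot (gradient (Weps N xbar eps0 eps1 eps2 eps3) x)
            (closed_loop N x + B *m d)
          <= - alpha * enorm (x - xbar) ^+ 2.
Proof.
case/andP: hgamma => gamma_gt gamma_lt.
have gamma_ge0 : 0 <= gamma by rewrite (le_trans _ (ltW gamma_gt)).
have xbar_region : angle_region N gamma xbar.
  move=> k; rewrite -ler_norml (le_trans _ (ltW gamma_gt))//.
  have : `|line_angles N (st_phi xbar) k 0|
      <= mx_norm (line_angles N (st_phi xbar)).
    rewrite mx_normrE.
    exact: (@le_bigmax _ _ _ 0
      (fun ij => `|line_angles N (st_phi xbar) ij.1 ij.2|) (k, 0)).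
  by [].
have [c [K [c_gt0 K_ge0 lower]]] :=
  Weps_lower hS hxbar gamma_lt gamma_ge0 xbar_region.
have K1_gt0 : 0 < 2 * (K + 1) by lra.
(* Below this cap [e * K] is at most [c / 2], so half of the lower bound survives; the [+ 1] avoids
   division by zero. *)
have cap_gt0 : 0 < c / (2 * (K + 1)) by rewrite divr_gt0.
have [delta [e [alpha [/andP[delta_gt0 delta_le1] /andP[e_gt0 e_le] alpha_gt0 diss]]]] :=
  Weps_dissipation hS hxbar gamma_lt gamma_ge0 xbar_region cap_gt0.
have eK : e * K <= c / 2.
  move: e_le; rewrite ler_pdivlMr// => e_le; nra.
have [C C_ge0 upper] := Weps_upper hS hxbar delta e.
have [L L_ge0 Lbound] := dWeps_bound hS hxbar delta e.
have [b b_ge0 bbound] := enorm_mulmx B.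
have WC1 := C1_Weps hS xbar e delta 1 delta.
(* The disturbance contributes at most [L * b * chi] times the squared distance, hence at most half
   of [alpha]. *)
pose chi := alpha / 2 / (L * b + 1).
have Lb_gt0 : 0 < L * b + 1 by rewrite ltr_wpDl// mulr_ge0.
have chi_gt0 : 0 < chi by rewrite !divr_gt0.
have key x d : angle_region N gamma x -> enorm d <= chi * enorm (x - xbar) ->
    2^-1 * c * enorm (x - xbar) ^+ 2 <= Weps N xbar e delta 1 delta x
      <= 2^-1 * (2 * (C + 1)) * enorm (x - xbar) ^+ 2 /\
    dot (gradient (Weps N xbar e delta 1 delta) x)
        (closed_loop N x + B *m d)
      <= - (alpha / 2) * enorm (x - xbar) ^+ 2.
  move=> xreg dchi.
  have X0 := sqr_ge0 (enorm (x - xbar)).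
  split.
    apply/andP; split.
      apply: le_trans (lower delta e x _ (ltW e_gt0) xreg); last first.
        by rewrite (ltW delta_gt0).
      by rewrite ler_wpM2r//; lra.
    by rewrite (le_trans (upper x))// ler_wpM2r//; lra.
  rewrite dotDr !(C1_gradient WC1) (_ : - (alpha / 2) * _ =
    - alpha * enorm (x - xbar) ^+ 2 + alpha / 2 * enorm (x - xbar) ^+ 2);
    last by field.
  apply: lerD; first exact: diss.
  rewrite (le_trans (ler_norm _))// (le_trans (Lbound _ _))//.
  have step : enorm (B *m d) <= b * (chi * enorm (x - xbar)).
    by rewrite (le_trans (bbound d))// ler_wpM2l.
  have n0 := enorm_ge0 (x - xbar).
  apply: (@le_trans _ _ (L * (enorm (x - xbar) * (b * (chi * enorm (x - xbar)))))).
    by rewrite !ler_wpM2l.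
  rewrite (_ : L * _ = L * b * chi * enorm (x - xbar) ^+ 2); last by ring.
  rewrite ler_wpM2r// /chi mulrA ler_pdivrMr// mulrC ler_wpM2l//; first lra.
  lra.
have a_gt0 : 0 < alpha / 2 by rewrite divr_gt0.
have C_gt0 : 0 < 2 * (C + 1) by lra.
exists e, delta, 1, delta; split; first by split.
split; last by exists (alpha / 2), chi, c, (2 * (C + 1)); split.
split; first exact: C1_continuously_differentiable WC1.
exists (fun r => 2^-1 * c * r ^+ 2), (fun r => 2^-1 * (2 * (C + 1)) * r ^+ 2).
exists (fun r => alpha / 2 * r ^+ 2), (fun r => chi * r); split.
  split; [apply: class_Kinfty_square|apply: class_Kinfty_square|
    exact: class_Kinfty_square|exact: class_Kinfty_linear];
    by rewrite mulr_gt0// invr_gt0.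
move=> x xreg; split.
  (* The bounds on [Weps] do not involve the disturbance, so [key] is used at the always admissible
     value zero. *)
  have d0 : enorm (0 : 'cV[R]_q) <= chi * enorm (x - xbar).
    rewrite /enorm dot0l sqrtr0 mulr_ge0 ?enorm_ge0//; exact: ltW.
  by case: (key x 0 xreg d0).
by move=> d /(key x d xreg)[_]; rewrite mulNr.
Qed.
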